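(* Let $(S_n,\tau)$ be a temporal star with at most $k$ times at any edge and such that every two consecutive times at any edge differ by at least $\ell$ and by at most $u$. There is an algorithm that decides whether $(S_n,\tau)$ is explorable in time $2^{\mathcal{O}(ku/\ell)}\Lambda$, where $\Lambda$ is the lifetime of the input.
   Context: A temporal graph is a pair $(G,\tau)$ where $G$ is a finite simple graph and $\tau: E(G)\to 2^{\mathbb{N}}$ assigns to each edge $e$ a finite set $\tau(e)$ of times at which $e$ is active; $(e,t)$ with $t\in\tau(e)$ is a time-edge. The lifetime is $\Lambda=\max_e\max\tau(e)$. A (strict) temporal $(x,y)$-walk is a sequence of time-edges $(e_1,t_1),\dots,(e_n,t_n)$ with $e_1,\dots,e_n$ a walk from $x$ to $y$ in $G$ and $t_1<\dots<t_n$; closed if $x=y$. Let $S_n$ be the star with $n$ leaves; a temporal star $(S_n,\tau)$ is explorable if it admits a closed temporal walk starting (and ending) at the center that visits every leaf. ''Consecutive times'' at $e$ are elements $t<t'$ of $\tau(e)$ with no element of $\tau(e)$ strictly between them. *)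

(* Defs.v *)
From HB Require Import structures.
From mathcomp Require Import all_boot all_order.
From mathcomp Require Import finmap.

Set Implicit Arguments.
Unset Strict Implicit.
Unset Printing Implicit Defensive.

(** * Temporal graphs *)

Record sgraph := SGraph {
  vertex :> finType;
  adj : rel vertex;
  adj_sym : symmetric adj;
  adj_irr : irreflexive adj
}.

Definition edges (G : sgraph) : {set {set G}} :=
  [set [set p.1; p.2] | p : G * G & adj p.1 p.2].

(* A temporal graph is a pair of [G : sgraph] and [tau : labelling G]; the
   values of [tau] outside [edges G] are never used. *)
Definition labelling (G : sgraph) := {set G} -> {fset nat}.

Section TemporalGraph.
Variables (G : sgraph) (tau : labelling G).

(* The lifetime is 0 if there is no time-edge. *)
Definition lifetime : nat := \max_(e in edges G) \max_(t <- tau e) t.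

Definition time_edge (te : {set G} * nat) : bool :=
  (te.1 \in edges G) && (te.2 \in tau te.1).

(* [w] is the sequence of time-edges, and [x :: vs] the sequence of vertices
   traversed by the underlying walk. *)
Definition temporal_walk (x y : G) (vs : seq G) (w : seq ({set G} * nat)) :=
  [/\ all time_edge w,
      unzip1 w = pairmap (fun a b => [set a; b]) x vs,
      last x vs = y
    & sorted ltn (unzip2 w)].

Definition at_most_times (k : nat) :=
  forall e, e \in edges G -> #|` tau e| <= k.

Definition consecutive (e : {set G}) (t t' : nat) :=
  [/\ t \in tau e, t' \in tau e, t < t'
    & forall r, r \in tau e -> ~~ (t < r < t')].

Definition gaps_between (l u : nat) :=
  forall e t t', e \in edges G -> consecutive e t t' -> l <= t' - t <= u.

End TemporalGraph.

(** * Temporal stars *)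

Section Star.
Variable n : nat.

(* [None] is the center, [Some i] are the leaves. *)
Definition star_adj : rel (option 'I_n) := fun x y => isSome x (+) isSome y.

Lemma star_adj_sym : symmetric star_adj.
Proof. by move=> x y; rewrite /star_adj addbC. Qed.

Lemma star_adj_irr : irreflexive star_adj.
Proof. by move=> x; rewrite /star_adj addbb. Qed.

Definition star : sgraph := SGraph star_adj_sym star_adj_irr.

Definition center : star := None.
Definition leaf (i : 'I_n) : star := Some i.

Definition explorable (tau : labelling star) : Prop :=
  exists vs w, temporal_walk tau center center vs w /\
               forall i : 'I_n, leaf i \in center :: vs.

(* The input word: the number of leaves, then for each leaf the number of times
   at its edge followed by these times in increasing order. *)
Definition encode (tau : labelling star) : seq nat :=
  n :: flatten [seq let s := sort leq (tau [set center; leaf i]) in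
                    size s :: s | i <- enum 'I_n].

End Star.

(** * Random access machine

   While-programs over finitely many unbounded arrays of natural numbers
   (array names are literals of the program; a scalar variable is a cell with a
   constant index), with indirect addressing. The only arithmetic operations
   are addition and truncated subtraction, and each elementary operation has
   unit cost: there is no multiplication, division or bitwise operation. *)

Inductive expr :=
  | Cst of nat
  | Get of nat & expr
  | Add of expr & expr
  | Sub of expr & expr.

Inductive prog :=
  | Skip
  | Put of nat & expr & expr
  | Seq of prog & prog
  | If of expr & prog & prog
  | While of expr & prog.

Definition store := nat -> nat -> nat.

Fixpoint eval (s : store) (e : expr) : nat :=
  match e with
  | Cst c => c
  | Get a e => s a (eval s e)
  | Add e1 e2 => eval s e1 + eval s e2
  | Sub e1 e2 => eval s e1 - eval s e2
  end.

Fixpoint cost (e : expr) : nat :=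
  match e with
  | Cst _ => 1
  | Get _ e => (cost e).+1
  | Add e1 e2 | Sub e1 e2 => (cost e1 + cost e2).+1
  end.

Definition update (s : store) (a i v : nat) : store :=
  fun b j => if (b == a) && (j == i) then v else s b j.

(* [exec p s T s'] : started in [s], the program [p] halts in [s'] after time
   [T]. Tests succeed on nonzero values. *)
Inductive exec : prog -> store -> nat -> store -> Prop :=
  | ExecSkip s : exec Skip s 1 s
  | ExecPut a e1 e2 s :
      exec (Put a e1 e2) s (cost e1 + cost e2).+1
           (update s a (eval s e1) (eval s e2))
  | ExecSeq p q s T s' T' s'' :
      exec p s T s' -> exec q s' T' s'' -> exec (Seq p q) s (T + T') s''
  | ExecIfT e p q s T s' :
      eval s e != 0 -> exec p s T s' -> exec (If e p q) s (cost e + T).+1 s'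
  | ExecIfF e p q s T s' :
      eval s e = 0 -> exec q s T s' -> exec (If e p q) s (cost e + T).+1 s'
  | ExecWhileT e p s T s' T' s'' :
      eval s e != 0 -> exec p s T s' -> exec (While e p) s' T' s'' ->
      exec (While e p) s (cost e + T + T').+1 s''
  | ExecWhileF e p s :
      eval s e = 0 -> exec (While e p) s (cost e).+1 s.

Lemma exec_det p s T1 s1 T2 s2 :
  exec p s T1 s1 -> exec p s T2 s2 -> T1 = T2 /\ s1 = s2.
Proof.
move=> H; elim: H T2 s2 => {p s T1 s1}.
- by move=> s T2 s2 H; inversion H.
- by move=> a e1 e2 s T2 s2 H; inversion H.
- move=> p q s T s' T' s'' _ IH1 _ IH2 T2 s2 H; inversion H; subst.
  by case: (IH1 _ _ ltac:(eassumption)) => ??; subst;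
     case: (IH2 _ _ ltac:(eassumption)) => ??; subst.
- move=> e p q s T s' /eqP ne _ IH T2 s2 H; inversion H; subst => //.
  by case: (IH _ _ ltac:(eassumption)) => ??; subst.
- move=> e p q s T s' e0 _ IH T2 s2 H; inversion H; subst.
    by move: H6; rewrite e0.
  by case: (IH _ _ ltac:(eassumption)) => ??; subst.
- move=> e p s T s' T' s'' /eqP ne _ IH1 _ IH2 T2 s2 H; inversion H; subst => //.
  by case: (IH1 _ _ ltac:(eassumption)) => ??; subst;
     case: (IH2 _ _ ltac:(eassumption)) => ??; subst.
- move=> e p s e0 T2 s2 H; inversion H; subst => //.
  by move: H2; rewrite e0.
Qed.

(* Array 0 holds the input word; every other cell is initially 0. *)
Definition load (x : seq nat) : store :=
  fun a i => if a == 0 then nth 0 x i else 0.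

(* The answer is read off cell 0 of array 1. *)
Definition accepting (s : store) : bool := s 1 0 != 0.

Definition decides_within (p : prog) (x : seq nat) (P : Prop) (B : nat) :=
  exists T s, [/\ exec p (load x) T s, T <= B & accepting s <-> P].

(* Main.v *)
Require Import Defs.
From mathcomp Require Import all_boot all_order.
From mathcomp Require Import finmap zify.

Set Implicit Arguments.
Unset Strict Implicit.
Unset Printing Implicit Defensive.

(** A star is explorable iff every leaf can be given a pair of consecutive times
    of its edge so that the resulting closed intervals are pairwise disjoint.
    Such a choice is found by sweeping over the times [t] and recording, for a
    set of leaves, the earliest end of a schedule visiting exactly this set: when
    [(a, t)] is a pair of consecutive times of leaf [i], every set not containing
    [i] whose schedule ends before [a] is extended by [i].  At time [t] only the
    sets matter that contain all leaves whose last time has passed and no leaf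
    whose first time is still to come, so only the live leaves are free.  In
    an explorable star the intervals of the live leaves are disjoint, have length
    at least [l], and lie within distance [(k - 1) u] of [t]; hence at most
    [2 k u / l] leaves are live, and the event is skipped whenever this fails.

    A set of leaves is coded by the sum of the [2 ^ i], which directly indexes
    the unbounded array of earliest ends; the candidate sets are enumerated as the
    subset sums of the live codes.  The [m] leaves read so far need [m] distinct
    positive end times, so reading stops as soon as [m] exceeds the largest time
    met: this keeps the time linear in the lifetime even if [n] is larger. *)

(** * Binary codes of finite sets of leaves *)

Definition wsum (s : seq nat) : nat := \sum_(i <- s) 2 ^ i.

Lemma wsum_cat s s' : wsum (s ++ s') = wsum s + wsum s'.
Proof. by rewrite /wsum big_cat. Qed.

Lemma wsum_cons i s : wsum (i :: s) = 2 ^ i + wsum s.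
Proof. by rewrite /wsum big_cons. Qed.

Lemma wsum_rcons s i : wsum (rcons s i) = wsum s + 2 ^ i.
Proof. by rewrite -cats1 wsum_cat /wsum big_seq1. Qed.

Lemma wsum_iota n : wsum (iota 0 n) = (2 ^ n).-1.
Proof.
elim: n => [|n IHn]; first by rewrite /wsum big_nil.
by rewrite -addn1 iotaD wsum_cat IHn /wsum big_seq1 addn1 expnS add0n; lia.
Qed.

(** Parity determines the lowest digit; cancelling it and halving leaves the same claim for the
    shifted digits. *)
Lemma binary_inj N (b c : nat -> bool) :
  \sum_(i < N) b i * 2 ^ i = \sum_(i < N) c i * 2 ^ i ->
  forall i, i < N -> b i = c i.
Proof.
elim: N b c => [//|N IHN] b c.
have shift (f : nat -> bool) : \sum_(i < N.+1) f i * 2 ^ i =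
    f 0 + (\sum_(i < N) f i.+1 * 2 ^ i).*2.
  rewrite big_ord_recl expn0 muln1 -mul2n big_distrr /=; congr (_ + _).
  by apply: eq_bigr => i _; rewrite expnS mulnCA.
rewrite !shift => E.
have e0 : b 0 = c 0.
  by move: (congr1 odd E); rewrite !oddD !odd_double !addbF; case: (b 0); case: (c 0).
move: E; rewrite e0 => /addnI/double_inj E [|i] // ltiN.
exact: (IHN (fun i => b i.+1) (fun i => c i.+1)).
Qed.

(** Without duplicates the binary digits are given by membership, so uniqueness of binary expansions
    applies. This makes codes faithful table indices. *)
Lemma wsum_inj s s' : uniq s -> uniq s' -> wsum s = wsum s' -> s =i s'.
Proof.
move=> us us' E j.
pose N := (\max_(i <- s ++ s') i).+1.
have ltN i : i \in s ++ s' -> i < N.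
  by move=> si; rewrite ltnS; apply: (@leq_bigmax_seq _ _ xpredT id).
have bits r : uniq r -> {subset r <= s ++ s'} ->
    wsum r = \sum_(i < N) (nat_of_ord i \in r) * 2 ^ i.
  move=> ur sr; rewrite /wsum (@perm_big _ _ _ _ _ [seq i <- iota 0 N | i \in r]).
    rewrite big_filter big_mkcond -[iota 0 N]/(index_iota 0 N) big_mkord.
    by apply: eq_bigr => i _; case: ifP; rewrite ?mul1n.
  apply: uniq_perm; rewrite ?filter_uniq ?iota_uniq // => i.
  rewrite mem_filter mem_iota add0n /=; case ri: (i \in r) => //=.
  by rewrite ltN // sr.
have [jN|] := ltnP j N.
  apply: (@binary_inj N (mem s) (mem s')) => //=.
  by rewrite -!bits // => i; rewrite mem_cat => ->; rewrite ?orbT.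
rewrite leqNgt => /negP nj; have: j \notin s ++ s' by apply/negP => /ltN.
by rewrite mem_cat negb_or => /andP[/negPf-> /negPf->].
Qed.

Lemma perm_wsum s s' : perm_eq s s' -> wsum s = wsum s'.
Proof. exact: perm_big. Qed.

Definition extend (E : seq nat) (w : nat) : seq nat := E ++ [seq y + w | y <- E].
(** The left fold lists the subset sums in the order in which the program doubles its array. *)
Definition sums (E : seq nat) (ws : seq nat) : seq nat := foldl extend E ws.

Lemma size_extend E w : size (extend E w) = (size E).*2.
Proof. by rewrite size_cat size_map addnn. Qed.

Lemma mem_sums E s y :
  y \in sums E [seq 2 ^ i | i <- s] <->
  exists z d, [/\ z \in E, subseq d s & y = z + wsum d].
Proof.
elim: s E y => [|i s IHs] E y.
  split=> [yE|[z [d [zE]]]].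
    by exists y, [::]; rewrite /wsum big_nil addn0.
  by case: d => // _ ->; rewrite /wsum big_nil addn0.
rewrite -[sums E _]/(sums (extend E (2 ^ i)) [seq 2 ^ j | j <- s]) IHs.
split=> [[z [d [+ sd ->]]]|[z [d [zE + ->]]]].
  rewrite mem_cat => /orP[zE|/mapP[x xE ->]].
    by exists z, d; split=> //; apply: (subseq_trans sd); apply: subseq_cons.
  by exists x, (i :: d); rewrite /= eqxx wsum_cons addnA.
case: d => [|j d] sd.
  by exists z, [::]; rewrite mem_cat zE sub0seq.
move: sd => /=; case: eqP => [-> sd|_ sd].
  exists (z + 2 ^ i), d; rewrite mem_cat wsum_cons addnA; split=> //.
  by apply/orP; right; apply: map_f.
by exists z, (j :: d); rewrite mem_cat zE.
Qed.

(** * Schedules *)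

(* The visit [(i, (a, b))] leaves the center for leaf [i] at time [a] and is
   back at time [b]. *)
Definition visit := (nat * (nat * nat))%type.

Section Schedules.
Variable tss : seq (seq nat).
Implicit Types (v x : visit) (c : seq visit).

(** A two-element infix of the sorted list of times is a pair of consecutive times. *)
Definition valid v := infix [:: v.2.1; v.2.2] (nth [::] tss v.1).
Definition before : rel visit := fun v v' => v.2.2 < v'.2.1.
Definition schedule c := [&& all valid c, pairwise before c & uniq (unzip1 c)].
Definition schedulable :=
  exists2 c, schedule c & forall i, i < size tss -> i \in unzip1 c.

Hypothesis sorted_tss : forall s, s \in tss -> sorted ltn s.

Lemma mem_nth_tss i a : a \in nth [::] tss i -> nth [::] tss i \in tss.
Proof.
by case: (ltnP i (size tss)) => [/(mem_nth [::])|/(nth_default [::])->].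
Qed.

Lemma sorted_nth i : sorted ltn (nth [::] tss i).
Proof.
case: (ltnP i (size tss)) => [/(mem_nth [::])/sorted_tss //|].
by move/(nth_default [::])->.
Qed.

Lemma nth_tss_size i a : a \in nth [::] tss i -> i < size tss.
Proof. by case: ltnP => // /(nth_default [::])->. Qed.

Lemma valid_mem v : valid v ->
  (v.2.1 \in nth [::] tss v.1) /\ (v.2.2 \in nth [::] tss v.1).
Proof.
by move=> /mem_infix sv; split; apply: sv; rewrite !inE eqxx ?orbT.
Qed.

Lemma valid_lt v : valid v -> v.2.1 < v.2.2.
Proof.
case/infixP=> [s1 [s2 E]]; have := sorted_nth v.1; rewrite E.
by rewrite (sorted_pairwise ltn_trans) pairwise_cat => /and3P[_ _ /andP[/andP[]]].
Qed.

Lemma schedule_filter (P : pred visit) c : schedule c -> schedule (filter P c).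
Proof.
case/and3P=> vc pc uc; apply/and3P; split.
- by apply/allP => v; rewrite mem_filter => /andP[_ /(allP vc)].
- exact: pairwise_filter.
- by apply: subseq_uniq uc; apply: map_subseq; apply: filter_subseq.
Qed.

Lemma size_filter_leaves c (al : seq nat) : uniq al -> {subset al <= unzip1 c} ->
  size al <= size [seq v <- c | v.1 \in al].
Proof.
move=> ual sub; rewrite -(size_map fst); apply: uniq_leq_size => // i ial.
have /mapP[v vc iv] := sub i ial; apply/mapP; exists v => //.
by rewrite mem_filter -iv ial.
Qed.

(** Packing bound: the first interval takes length at least [L], and the others lie to the right of
    its end, which becomes the new [lo] of the induction. *)
Lemma schedule_size c lo hi L : schedule c ->
  {in c, forall v, v.2.1 + L <= v.2.2} ->
  {in c, forall v, lo <= v.2.1 /\ v.2.2 <= hi} -> lo <= hi ->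
  size c * L <= hi - lo.
Proof.
case/and3P=> _ + _; elim: c lo => [//|v c IHc] lo /= /andP[vc pc] gap bnd lohi.
have [lov vhi] := bnd v (mem_head _ _).
have := gap v (mem_head _ _) => gv.
have := IHc v.2.2 pc; rewrite mulSn => H; suff: size c * L <= hi - v.2.2 by lia.
apply: H => //.
- by move=> x xc; apply: gap; rewrite inE xc orbT.
- move=> x xc; split; first by have := allP vc x xc; rewrite /before; lia.
  by have [] := bnd x; rewrite ?inE ?xc ?orbT.
Qed.

(** Packing with unit length: the visits of the first [m] leaves are disjoint in the interval from 0
    to [M.-1], and each lasts at least 1. This justifies giving up while reading. *)
Lemma schedulable_time m M : schedulable -> m <= size tss ->
  (forall i t, i < m -> t \in nth [::] tss i -> t < M) -> m <= M.-1.
Proof.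
case=> c cs cf le_m tM.
have vc v : v \in c -> valid v by case/and3P: cs => /allP + _ _; apply.
rewrite -[m](size_iota 0) -[M.-1]subn0 -[size _]muln1.
apply: (@leq_trans (size [seq v <- c | v.1 \in iota 0 m] * 1)).
  rewrite !muln1; apply: size_filter_leaves => [|i]; first exact: iota_uniq.
  by rewrite mem_iota => /= ltm; apply: cf; apply: leq_trans le_m.
apply: schedule_size; first exact: schedule_filter.
- by move=> v; rewrite mem_filter => /andP[_ /vc/valid_lt]; rewrite addn1.
- move=> v; rewrite mem_filter mem_iota => /= /andP[ltm /vc/valid_mem[_ bin]].
  by split=> //; have := tM _ _ ltm bin; case: (M).
- by [].
Qed.

Lemma valid_size i c : schedule c -> i \in unzip1 c -> 1 < size (nth [::] tss i).
Proof.
by case/and3P=> /allP vc _ _ /mapP[v /vc /size_infix /= + ->].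
Qed.

End Schedules.

(** * Time-edge events *)

(* The event [((i, p), (t, r))] says that the edge of leaf [i] is active at time
   [t], that [p] is one more than its previous time ([0] if there is none), and
   that [r] of its times are larger than [t]. *)
Definition event := ((nat * nat) * (nat * nat))%type.
Definition ev_leaf (e : event) := e.1.1.
Definition ev_from (e : event) := e.1.2.
Definition ev_time (e : event) := e.2.1.
Definition ev_rem (e : event) := e.2.2.

Fixpoint leaf_events (i p : nat) (s : seq nat) : seq event :=
  if s is t :: s' then ((i, p), (t, size s')) :: leaf_events i t.+1 s' else [::].

Definition events (tss : seq (seq nat)) (r : nat) : seq event :=
  flatten [seq leaf_events i 0 (nth [::] tss i) | i <- iota 0 r].

Lemma size_leaf_events i p s : size (leaf_events i p s) = size s.
Proof. by elim: s p => //= t s IHs p; rewrite IHs. Qed.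

Lemma eventsS tss r :
  events tss r.+1 = events tss r ++ leaf_events r 0 (nth [::] tss r).
Proof. by rewrite /events -addn1 iotaD map_cat flatten_cat /= cats0. Qed.

Lemma mem_leaf_events i p s e :
  e \in leaf_events i p s <->
  exists s1 s2, s = s1 ++ ev_time e :: s2 /\
    [/\ ev_leaf e = i, ev_from e = last p (map S s1) & ev_rem e = size s2].
Proof.
elim: s p => [|t s IHs] p /=.
  by split=> // [[[|? ?] [? []]]].
rewrite inE; split=> [/orP[/eqP->|/IHs[s1 [s2 [-> [? ? ?]]]]]|].
- by exists [::], s.
- by exists (t :: s1), s2.
case=> [[|t' s1] [s2 [/= []]]].
  by case: e {IHs} => [[? ?] [? ?]]; rewrite /ev_time /ev_leaf /ev_from /ev_rem /=;
     move=> -> -> [-> -> ->]; rewrite eqxx.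
move=> <- {t'} Es [? ? ?]; apply/orP; right; apply/IHs.
by exists s1, s2.
Qed.

Lemma mem_events tss r e :
  e \in events tss r <->
  ev_leaf e < r /\ exists s1 s2, nth [::] tss (ev_leaf e) = s1 ++ ev_time e :: s2
    /\ ev_from e = last 0 (map S s1) /\ ev_rem e = size s2.
Proof.
split=> [/flatten_mapP[i]|[ltr [s1 [s2 [E [? ?]]]]]].
  rewrite mem_iota add0n /= => ltir /mem_leaf_events[s1 [s2 [E [-> ? ?]]]].
  by split=> //; exists s1, s2.
apply/flatten_mapP; exists (ev_leaf e); first by rewrite mem_iota.
by apply/mem_leaf_events; exists s1, s2.
Qed.

(** A time has a unique position in the list of its leaf, and the parts before and after it
    determine the rest of the event. *)
Lemma events_inj tss r : (forall s, s \in tss -> sorted ltn s) ->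
  {in events tss r &, injective (fun e => (ev_leaf e, ev_time e))}.
Proof.
move=> st [[i p] [t k]] [[i' p'] [t' k']].
move=> /mem_events[_ [s1 [s2 [E1 [E2 E3]]]]] /mem_events[_ [u1 [u2 [F1 [F2 F3]]]]].
rewrite /ev_leaf /ev_time /ev_from /ev_rem /= in E1 E2 E3 F1 F2 F3 *.
case=> ii tt; rewrite -ii -tt in F1 *.
have us : uniq (nth [::] tss i).
  by apply: (sorted_uniq ltn_trans ltnn); exact: sorted_nth.
have Es : size s1 = size u1.
  have ix s s' : nth [::] tss i = s ++ t :: s' -> index t (nth [::] tss i) = size s.
    move=> E; move: us; rewrite E cat_uniq => /and3P[_ /= /norP[nt _] _].
    by rewrite index_cat (negPf nt) /= eqxx addn0.
  by rewrite -(ix _ _ E1) -(ix _ _ F1).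
move: F1; rewrite E1 => /eqP; rewrite eqseq_cat // => /andP[/eqP E4 /eqP[E5]].
by rewrite E2 F2 E3 F3 E4 E5.
Qed.

Lemma events_uniq tss r : (forall s, s \in tss -> sorted ltn s) ->
  uniq (events tss r).
Proof.
move=> st; elim: r => [//|r IHr]; rewrite eventsS cat_uniq IHr /=.
apply/andP; split.
  apply/hasPn => e /mem_leaf_events[_ [_ [_ [Er _ _]]]].
  by apply/negP => /mem_events[]; rewrite Er ltnn.
have E p s : [seq ev_time e | e <- leaf_events r p s] = s.
  by elim: s p => //= t s IHs p; rewrite IHs.
apply: (map_uniq (f := ev_time)); rewrite E.
by apply: (sorted_uniq ltn_trans ltnn); exact: sorted_nth.
Qed.

Lemma size_events tss r K : (forall s, s \in tss -> size s <= K) ->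
  size (events tss r) <= r * K.
Proof.
move=> szK; elim: r => [//|r IHr].
rewrite eventsS size_cat size_leaf_events mulSnr leq_add //.
case: (ltnP r (size tss)) => [/(mem_nth [::])/szK //|].
by move/(nth_default [::])->.
Qed.

Lemma event_of_visit tss v : valid tss v ->
  exists2 e, e \in events tss (size tss) &
    [/\ ev_leaf e = v.1, ev_from e = v.2.1.+1 & ev_time e = v.2.2].
Proof.
move=> vv; have [av _] := valid_mem vv.
case/infixP: vv => s1 [s2 E].
exists ((v.1, v.2.1.+1), (v.2.2, size s2)) => //.
apply/mem_events; split; first exact: nth_tss_size av.
exists (rcons s1 v.2.1), s2; rewrite cat_rcons map_rcons last_rcons; split=> //.
Qed.

Lemma visit_of_event tss r e : e \in events tss r -> 0 < ev_from e ->
  valid tss (ev_leaf e, ((ev_from e).-1, ev_time e)).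
Proof.
case/mem_events=> _ [s1 [s2 [E [-> _]]]].
case/lastP: s1 E => [//|s1 a] E _; rewrite map_rcons last_rcons /=.
by apply/infixP; exists s1, s2; rewrite E cat_rcons.
Qed.

(** The reversal matches the linked lists of the program, where a newly read event is put in
    front. *)
Definition bucket (t : nat) (evs : seq event) : seq event :=
  rev [seq e <- evs | ev_time e == t].

Definition sweep (M : nat) (evs : seq event) : seq event :=
  flatten [seq bucket t evs | t <- iota 0 M].

Lemma sweepS M evs : sweep M.+1 evs = sweep M evs ++ bucket M evs.
Proof. by rewrite /sweep -addn1 iotaD map_cat flatten_cat /= cats0. Qed.

Lemma mem_bucket t evs e : (e \in bucket t evs) = (ev_time e == t) && (e \in evs).
Proof. by rewrite mem_rev mem_filter. Qed.

Lemma mem_sweep M evs e : (e \in sweep M evs) = (ev_time e < M) && (e \in evs).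
Proof.
apply/flatten_mapP/andP => [[t]|[ltM ein]].
  by rewrite mem_iota mem_bucket => /= ltM /andP[/eqP-> ->].
by exists (ev_time e); rewrite ?mem_iota ?mem_bucket ?eqxx.
Qed.

Lemma sweep_uniq M evs : uniq evs -> uniq (sweep M evs).
Proof.
move=> ue; elim: M => [//|M IHM]; rewrite sweepS cat_uniq IHM rev_uniq filter_uniq // andbT.
by apply/hasPn => e; rewrite mem_bucket mem_sweep => /andP[/eqP-> _]; rewrite ltnn.
Qed.

Lemma sweep_sorted M evs : pairwise (fun e e' => ev_time e <= ev_time e') (sweep M evs).
Proof.
elim: M => [//|M IHM]; rewrite sweepS pairwise_cat IHM /=; apply/andP; split.
  apply/allrelP => e e'; rewrite mem_sweep mem_bucket.
  by move=> /andP[/ltnW + _] /andP[/eqP-> _].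
have: all (fun e => ev_time e == M) (bucket M evs).
  by apply/allP => e; rewrite mem_bucket => /andP[].
elim: (bucket M evs) => //= e s IHs /andP[/eqP eM aM]; rewrite IHs // andbT.
by apply/allP => e' /(allP aM)/eqP->; rewrite eM.
Qed.

Lemma size_sweep M evs : size (sweep M evs) <= size evs.
Proof.
suff -> : size (sweep M evs) = count (fun e => ev_time e < M) evs by apply: count_size.
elim: M => [|M IHM]; first by rewrite (@eq_count _ _ pred0) ?count_pred0.
rewrite sweepS size_cat IHM size_rev size_filter -count_predUI.
rewrite [X in _ + X](_ : _ = 0) ?addn0; last first.
  rewrite (@eq_count _ _ pred0) ?count_pred0 // => e /=; apply/negP => /andP[ltM /eqP tM].
  by rewrite tM ltnn in ltM.
by apply: eq_count => e /=; rewrite ltnS [in RHS]leq_eqVlt orbC.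
Qed.

(** * The dynamic program *)

(* [tab] maps the code of a set of leaves to two more than the earliest time at
   which a schedule of exactly that set can end (one for the empty set), and
   to 0 if no such schedule is known.  [base] is the code of the leaves whose
   last time has passed, and [live] lists the other leaves met so far. *)
Record dp := DP { tab : nat -> nat; base : nat; live : seq nat }.

Definition dp0 := DP (fun y => if y == 0 then 1 else 0) 0 [::].

(** As [F y] is an end plus two and [p] a start plus one, [F y <= p] says that the stored schedule
    ends strictly before the visit starts. The empty set, with value 1, admits every visit; [p = 0],
    for a first time, admits none. An existing entry is kept, since a sweep by increasing time wrote
    it no later. *)
Definition settle (w p v : nat) (F : nat -> nat) (y : nat) : nat -> nat :=
  if [&& F y != 0, F y <= p & F (y + w) == 0]
  then fun z => if z == y + w then v else F z else F.

Definition others (i : nat) (al : seq nat) := [seq j <- al | j != i].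

(** The current leaf leaves the live list before the subset sums are formed, and then returns to it
    or moves to [base]. The bound [B.*2] is the width of a window of radius [B] around the current
    time. *)
Definition step (L B : nat) (st : dp) (e : event) : dp :=
  if size (live st) * L <= B.*2 then
    let i := ev_leaf e in
    let al := others i (live st) in
    let F := foldl (settle (2 ^ i) (ev_from e) (ev_time e).+2) (tab st)
                   (sums [:: base st] [seq 2 ^ j | j <- al]) in
    if ev_rem e != 0 then DP F (base st) (rcons al i)
    else DP F (base st + 2 ^ i) al
  else st.

Section Settle.
Variables (w p v : nat).
Hypothesis v_gt0 : v != 0.

Lemma settle_keep F ys z : F z != 0 -> foldl (settle w p v) F ys z = F z.
Proof.
elim: ys F => //= y ys IHys F Fz.
have E : settle w p v F y z = F z.
  rewrite /settle; case: ifP => // /and3P[_ _ F0]; case: eqP => // E.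
  by rewrite E (eqP F0) in Fz.
by rewrite IHys E.
Qed.

Lemma settle_or F ys z :
  foldl (settle w p v) F ys z = F z \/ foldl (settle w p v) F ys z = v.
Proof.
elim: ys F => /= [|y ys IHys] F; first by left.
have [->|->] := IHys (settle w p v F y); last by right.
by rewrite /settle; case: ifP => // _; [case: eqP => _; [right|left]|left].
Qed.

(** Nonzero entries are never overwritten, so the entry at [y] is unchanged when its turn comes;
    then [y + w] is already set or is set at once. *)
Lemma settle_hit F ys y : y \in ys -> F y != 0 -> F y <= p ->
  foldl (settle w p v) F ys (y + w) != 0.
Proof.
elim: ys F => //= x ys IHys F; rewrite inE => yin Fy Fp.
have kx : settle w p v F x y = F y.
  rewrite /settle; case: ifP => // /and3P[_ _ F0]; case: eqP => // E.
  by rewrite E (eqP F0) in Fy.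
case/orP: yin => [/eqP <-{x kx}|yin]; last by rewrite IHys // kx.
have ne0 : settle w p v F y (y + w) != 0.
  rewrite /settle Fy Fp /=; case: ifP => [_|/negbT//]; by rewrite eqxx.
by rewrite settle_keep.
Qed.

End Settle.

Section Correctness.
Variables (tss : seq (seq nat)) (L B M : nat).
Hypothesis sorted_tss : forall s, s \in tss -> sorted ltn s.
Hypothesis lt_tss : forall s t, s \in tss -> t \in s -> t < M.

Let evs := events tss (size tss).
Let ord := sweep M evs.
Let run pre := foldl (step L B) dp0 pre.

Let done (pre : seq event) i := has (fun e => (ev_leaf e == i) && (ev_rem e == 0)) pre.
Let begun (pre : seq event) i := has (fun e => ev_leaf e == i) pre.

Lemma mem_ord e : (e \in ord) = (e \in evs).
Proof.
rewrite mem_sweep; case ein: (e \in evs); rewrite ?andbF // andbT.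
move: ein => /mem_events[ltr [s1 [s2 [E _]]]].
apply: (lt_tss (mem_nth [::] ltr)).
by rewrite E mem_cat mem_head orbT.
Qed.

Lemma ord_uniq : uniq ord.
Proof. by apply/sweep_uniq/events_uniq. Qed.

Lemma ord_pre pre e post e' : ord = pre ++ e :: post -> e' \in pre ->
  ev_time e' <= ev_time e.
Proof.
move=> E pe'; have := sweep_sorted M evs; rewrite -/ord E pairwise_cat.
by case/and3P=> /allrelP/(_ e' e pe' (mem_head _ _)).
Qed.

Lemma ord_post pre e post e' : ord = pre ++ e :: post -> e' \in e :: post ->
  ev_time e <= ev_time e'.
Proof.
move=> E; have := sweep_sorted M evs; rewrite -/ord E pairwise_cat /=.
case/and3P=> _ _ /andP[/allP ap _]; rewrite inE => /orP[/eqP-> //|/ap //].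
Qed.

Lemma event_last e e' : e \in evs -> e' \in evs -> ev_leaf e' = ev_leaf e ->
  ev_rem e' = 0 -> ev_time e <= ev_time e'.
Proof.
case/mem_events=> _ [s1 [s2 [E _]]] /mem_events[_ [u1 [u2 [E' [_ r0]]]]] ll rem0.
move: r0 E'; rewrite rem0 ll; case: u2 => // _; rewrite E => E'.
have := sorted_nth sorted_tss (ev_leaf e); rewrite E E' (sorted_pairwise ltn_trans).
have : ev_time e \in u1 ++ [:: ev_time e'] by rewrite -E' mem_cat mem_head orbT.
rewrite cats1 mem_rcons inE pairwise_rcons => /orP[/eqP-> //|tu /andP[/allP/(_ _ tu)/= + _]].
exact: ltnW.
Qed.

(** An event without remaining times carries the last time of its leaf, so it can precede [e] only
    at the same time; then it equals [e], and [ord] would contain a duplicate. *)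
Lemma not_done pre e post : ord = pre ++ e :: post -> ~~ done pre (ev_leaf e).
Proof.
move=> E; apply/hasPn => e' pe'; apply/negP => /andP[/eqP ll /eqP r0].
have ein : e \in evs by rewrite -mem_ord E mem_cat mem_head orbT.
have ein' : e' \in evs by rewrite -mem_ord E mem_cat pe'.
have le1 := event_last ein ein' ll r0.
have le2 := ord_pre E pe'.
have ee : e' = e.
  apply: (events_inj sorted_tss ein' ein); rewrite ll; congr (_, _).
  by apply/eqP; rewrite eqn_leq le1 le2.
have := ord_uniq; rewrite E cat_uniq => /and3P[_ /hasPn/(_ e (mem_head _ _))/=].
by rewrite -ee pe'.
Qed.

(** * Soundness: every table entry comes from a schedule *)

Definition sound_tab (F : nat -> nat) := forall y, F y != 0 -> exists2 c, schedule tss c &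
  wsum (unzip1 c) = y /\ {in c, forall v, v.2.2.+2 <= F y}.

(** Leaves of [D] are done, but not conversely: an event is skipped when too many leaves are live,
    and a done leaf may then be missing from [base]. *)
Definition sound_sets pre b al := exists D,
  [/\ uniq al, uniq D, b = wsum D, {in al, forall i, i \notin D}
    & {in D, forall i, done pre i}].

Lemma done_rcons pre e i : done pre i -> done (rcons pre e) i.
Proof. by rewrite /done -cats1 has_cat => ->. Qed.

Lemma sound_settle e X F : e \in evs -> uniq X -> ev_leaf e \notin X ->
  sound_tab F -> sound_tab (settle (2 ^ ev_leaf e) (ev_from e) (ev_time e).+2 F (wsum X)).
Proof.
move=> ein uX nX sF; rewrite /settle; case: ifP => // /and3P[Fy Fp _] z /=.
case: (z =P wsum X + _) => [-> _|_]; last exact: sF.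
have [c cs [cX cF]] := sF _ Fy.
(* A nonzero entry that is at most [ev_from e] makes the latter positive, so the event does close a
   pair of consecutive times. *)
have vv := visit_of_event ein (leq_trans (eqbRL (lt0n _) Fy) Fp).
set v := (_, _) in vv.
exists (rcons c v); last first.
  rewrite /unzip1 map_rcons wsum_rcons -[[seq _ | _ <- c]]/(unzip1 c) cX; split=> //.
  have lt := valid_lt sorted_tss vv.
  move=> x; rewrite mem_rcons inE => /orP[/eqP-> //|xc].
  by have := cF x xc; move: lt Fp; rewrite /v /=; clear; lia.
case/and3P: cs => vc pc uc; apply/and3P; split.
- by rewrite all_rcons vv.
- rewrite pairwise_rcons pc andbT; apply/allP => x xc.
  by have := cF x xc; move: Fp; rewrite /before /v /=; clear; lia.
- rewrite /unzip1 map_rcons rcons_uniq -/(unzip1 c) uc andbT.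
  by rewrite (wsum_inj uc uX).
Qed.

Lemma sound_step pre e post st : ord = pre ++ e :: post ->
  sound_sets pre (base st) (live st) -> sound_tab (tab st) ->
  sound_sets (rcons pre e) (base (step L B st e)) (live (step L B st e)) /\
  sound_tab (tab (step L B st e)).
Proof.
move=> E [D [ual uD bD alD dD]] sF.
have ein : e \in evs by rewrite -mem_ord E mem_cat mem_head orbT.
have iD : ev_leaf e \notin D by apply/negP => /dD; apply/negP; exact: not_done E.
rewrite /step; case: ifP => _; last first.
  by split=> //; exists D; split=> // i /dD/done_rcons.
set F := foldl _ _ _.
have sF' : sound_tab F.
  rewrite {}/F.
  (* The fold is handled by induction on a list that is only required to lie inside the list of
     candidates. *)
  have : {subset sums [:: base st] [seq 2 ^ j | j <- others (ev_leaf e) (live st)]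
    <= sums [:: base st] [seq 2 ^ j | j <- others (ev_leaf e) (live st)]} by [].
  move: (tab st) sF; move: {1 3}(sums _ _) => ys; elim: ys => //= y ys IHys F sF sub.
  apply: IHys => [|x xin]; last by apply: sub; rewrite inE xin orbT.
  have /mem_sums[z [d [+ sd ->]]] := sub y (mem_head _ _).
  rewrite inE => /eqP->; rewrite bD -wsum_cat.
  have dal i : i \in d -> (i != ev_leaf e) && (i \in live st).
    by move/(mem_subseq sd); rewrite mem_filter.
  apply: sound_settle => //.
    rewrite cat_uniq uD (subseq_uniq sd) ?filter_uniq //= andbT.
    by apply/hasPn => i /dal/andP[_ /alD].
  by rewrite mem_cat (negPf iD) /=; apply/negP => /dal; rewrite eqxx.
case: ifP => [r0|/negbFE r0]; split=> //=.
  exists D; split=> //.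
  - by rewrite rcons_uniq filter_uniq // mem_filter eqxx.
  - by move=> i; rewrite mem_rcons inE mem_filter => /orP[/eqP-> //|/andP[_ /alD]].
  - by move=> i /dD/done_rcons.
exists (ev_leaf e :: D); split=> //=.
- by rewrite filter_uniq.
- by rewrite iD.
- by rewrite wsum_cons bD addnC.
- by move=> i; rewrite mem_filter inE negb_or => /andP[-> /alD].
- move=> i; rewrite inE => /orP[/eqP->|/dD/done_rcons //].
  by rewrite /done has_rcons eqxx r0.
Qed.

Lemma sound_run : sound_tab (tab (run ord)).
Proof.
suff H pre post : ord = pre ++ post ->
    sound_sets pre (base (run pre)) (live (run pre)) /\ sound_tab (tab (run pre)).
  by have [] := H ord [::] (esym (cats0 _)).
elim/last_ind: pre post => [|pre e IHpre] post E.
  split; first by exists [::]; rewrite /= /wsum big_nil.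
  move=> y /=; case: (y =P 0) => // -> _; exists [::] => //; split=> //.
  by rewrite /wsum big_nil.
rewrite cat_rcons in E; have [ss st] := IHpre _ E.
by rewrite /run foldl_rcons; apply: sound_step E ss st.
Qed.

Theorem run_sound : tab (run ord) (2 ^ size tss).-1 != 0 -> schedulable tss.
Proof.
case/sound_run=> c cs [E _]; exists c => // i lti.
have /and3P[_ _ uc] := cs.
by rewrite (wsum_inj uc (iota_uniq 0 (size tss))) ?mem_iota // wsum_iota.
Qed.

(** * Completeness: the table follows a given schedule of all leaves *)

Hypothesis gap_tss : forall s a b, s \in tss -> infix [:: a; b] s -> a + L <= b.
Hypothesis span_tss : forall s a b, s \in tss -> a \in s -> b \in s -> b <= a + B.

Section Complete.
Variable c : seq visit.
Hypothesis c_sched : schedule tss c.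
Hypothesis c_full : forall i, i < size tss -> i \in unzip1 c.

Definition exact_sets pre b al := exists D,
  [/\ uniq al, uniq D, b = wsum D, (forall i, (i \in D) = done pre i)
    & forall i, (i \in al) = begun pre i && ~~ done pre i].

Definition reached (pre : seq event) (v : visit) :=
  has (fun e => (ev_leaf e == v.1) && (ev_time e == v.2.2)) pre.

(** The bound is an inequality because the table may hold a schedule of the same set that ends
    earlier than the initial part of [c]. *)
Definition progress (pre : seq event) (F : nat -> nat) :=
  F 0 = 1 /\ forall c1 x c2, c = c1 ++ x :: c2 ->
  reached pre x -> 0 < F (wsum (unzip1 (rcons c1 x))) <= x.2.2.+2.

(** Keeps every value of the table at most the current time plus two, which bounds a newly found
    entry whichever candidate produced it. *)
Definition tab_bound (pre : seq event) (F : nat -> nat) :=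
  forall y, F y <= 1 \/ exists2 e, e \in pre & F y = (ev_time e).+2.

Lemma mem_c_valid x : x \in c -> valid tss x.
Proof. by case/and3P: c_sched => /allP vc _ _ /vc. Qed.

Lemma visit_event x : x \in c -> exists2 e, e \in ord &
    [/\ ev_leaf e = x.1, ev_from e = x.2.1.+1 & ev_time e = x.2.2].
Proof.
by move=> /mem_c_valid/event_of_visit[e ein he]; exists e; rewrite ?mem_ord.
Qed.

Lemma reached_before pre e post x : ord = pre ++ e :: post -> x \in c ->
  x.2.2 < ev_time e -> reached pre x.
Proof.
move=> E /visit_event[e' ein [e1 _ e3]] lt.
apply/hasP; exists e'; last by rewrite e1 e3 !eqxx.
move: ein; rewrite E mem_cat => /orP[//|/(ord_post E)]; by rewrite e3 leqNgt lt.
Qed.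

(** A live leaf has a time at most the current one and a time at least the current one, so all its
    times lie within [B] of it. The visits of [c] to live leaves are therefore disjoint intervals of
    length at least [L] in a window of width at most [B.*2]. *)
Lemma capacity pre e post b al : ord = pre ++ e :: post ->
  exact_sets pre b al -> size al * L <= B.*2.
Proof.
move=> E [D [ual _ _ _ alE]].
pose c' := [seq v <- c | v.1 \in al].
have sz : size al <= size c'.
  apply: size_filter_leaves => // i; rewrite alE => /andP[/hasP[e' pe' /eqP <-] _].
  apply: c_full; have: e' \in evs by rewrite -mem_ord E mem_cat pe'.
  by case/mem_events.
apply: (@leq_trans (size c' * L)); first by rewrite leq_mul2r sz orbT.
apply: (@leq_trans ((ev_time e + B) - (ev_time e - B))); last by clear; lia.
apply: (@schedule_size tss); first exact: schedule_filter.
- move=> v; rewrite mem_filter => /andP[_ /mem_c_valid vv].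
  by apply: gap_tss (vv); have [/mem_nth_tss] := valid_mem vv.
2: by clear; lia.
move=> v; rewrite mem_filter alE => /andP[/andP[bv dv] vc].
have vv := mem_c_valid vc; have [av bv'] := valid_mem vv.
have sin := mem_nth_tss av.
case/hasP: bv => e1 pe1 /eqP l1.
have le1 := ord_pre E pe1.
have ein1 : e1 \in evs by rewrite -mem_ord E mem_cat pe1.
have tin1 : ev_time e1 \in nth [::] tss v.1.
  by case/mem_events: ein1 => _ [s1 [s2 []]]; rewrite l1 => -> _; rewrite mem_cat mem_head orbT.
have [s1 Es] : exists s1, nth [::] tss v.1 = rcons s1 (last 0 (nth [::] tss v.1)).
  by case/lastP: (nth _ _ _) av => // s1 a _; exists s1; rewrite last_rcons.
set tl := last _ _ in Es.
have tinl : tl \in nth [::] tss v.1 by rewrite Es mem_rcons mem_head.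
(* The event of the last time of this leaf cannot be among the processed ones, because the leaf is
   not done. *)
pose el : event := ((v.1, last 0 (map S s1)), (tl, 0)).
have einl : el \in ord.
  rewrite mem_ord; apply/mem_events; split; first exact: nth_tss_size av.
  by exists s1, [::]; rewrite cats1 -Es.
have lel : ev_time e <= tl.
  rewrite -[tl]/(ev_time el); apply: (ord_post E).
  move: einl; rewrite E mem_cat => /orP[pl|//].
  by case/hasP: dv; exists el => //; rewrite /= eqxx.
have := span_tss sin av tinl; have := span_tss sin tin1 bv'.
by move: le1 lel; clear; lia.
Qed.

Lemma exact_step pre e post st : ord = pre ++ e :: post ->
  exact_sets pre (base st) (live st) ->
  exact_sets (rcons pre e) (base (step L B st e)) (live (step L B st e)).
Proof.
move=> E ex; have cap := capacity E ex; case: ex => D [ual uD bD DE alE].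
have nd := not_done E.
rewrite /step cap.
case: ifP => [r0|/negbFE r0] /=.
  exists D; split=> //.
  - by rewrite rcons_uniq filter_uniq // mem_filter eqxx.
  - by move=> i; rewrite DE /done has_rcons (negPf r0) andbF.
  - move=> i; rewrite mem_rcons inE mem_filter alE /done /begun !has_rcons.
    rewrite (negPf r0) andbF /= [in RHS]eq_sym; case: eqP => [->|_] //=.
exists (ev_leaf e :: D); split=> //=.
- by rewrite filter_uniq.
- by rewrite DE nd.
- by rewrite wsum_cons bD addnC.
- by move=> i; rewrite inE DE /done has_rcons r0 andbT eq_sym.
- move=> i; rewrite mem_filter alE /done /begun !has_rcons r0 andbT negb_or eq_sym.
  by case: eqP => //= _; rewrite andbF.
Qed.

(** The event that matters is the one closing a visit [x] of [c]: the leaves visited before [x] form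
    a candidate set, and its entry permits adding [x]. Visits reached earlier keep their entries. *)
Lemma progress_step pre e post st : ord = pre ++ e :: post ->
  exact_sets pre (base st) (live st) -> progress pre (tab st) ->
  tab_bound pre (tab st) ->
  progress (rcons pre e) (tab (step L B st e)) /\
  tab_bound (rcons pre e) (tab (step L B st e)).
Proof.
move=> E ex [F0 pF] bF; have cap := capacity E ex; case: ex => D [ual uD bD DE alE].
have nd := not_done E.
have -> : tab (step L B st e) = foldl (settle (2 ^ ev_leaf e) (ev_from e) (ev_time e).+2)
  (tab st) (sums [:: base st] [seq 2 ^ j | j <- others (ev_leaf e) (live st)]).
  by rewrite /step cap; case: ifP.
set ys := sums _ _; set F := foldl _ _ _.
have ein : e \in evs by rewrite -mem_ord E mem_cat mem_head orbT.
have bF' : tab_bound (rcons pre e) F.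
  move=> y; rewrite /F.
  have [->|->] := settle_or (2 ^ ev_leaf e) (ev_from e) (ev_time e).+2 (tab st) ys y.
    by have [|[e' pe' ->]] := bF y; [left|right; exists e' => //; rewrite mem_rcons inE pe' orbT].
  by right; exists e; rewrite ?mem_rcons ?mem_head.
split=> //; split=> [|c1 x c2 Ec]; first by rewrite /F settle_keep // F0.
rewrite /reached has_rcons orbC => /orP[rx|/andP[/eqP lx /eqP tx]].
  have := pF c1 x c2 Ec rx => /andP[F1 F2].
  by rewrite /F settle_keep -?lt0n // F1.
have xc : x \in c by rewrite Ec mem_cat mem_head orbT.
have fx : ev_from e = x.2.1.+1.
  have [e' ein' [l' f' t']] := visit_event xc.
  rewrite -f'; congr ev_from; rewrite mem_ord in ein'.
  by apply: (events_inj sorted_tss ein ein'); rewrite lx tx l' t'.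
have ltx := valid_lt sorted_tss (mem_c_valid xc).
case/and3P: (c_sched) => _ + uc; rewrite {1}Ec pairwise_cat => /and3P[/allrelP bc1 _ /=].
move=> /andP[/allP bc2 _].
have c1x v : v \in c1 -> v.2.2 < x.2.1 by move=> vc; apply: (bc1 v x vc (mem_head _ _)).
have c1c v : v \in c1 -> v \in c by move=> vc; rewrite Ec mem_cat vc.
set y := wsum (unzip1 c1).
(* Either [x] is the first visit and the entry is 1, or the visit just before [x] ends before [x]
   starts and has been reached. *)
have Fy : 0 < tab st y <= ev_from e.
  rewrite fx /y; case/lastP: {bc1} (c1) Ec c1x c1c => [|c1' v] Ec c1x c1c.
    by rewrite /wsum big_nil F0.
  have vin : v \in rcons c1' v by rewrite mem_rcons mem_head.
  have ltv := c1x v vin.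
  have rv : reached pre v.
    by apply: (reached_before E); rewrite ?c1c // tx; apply: ltn_trans ltv ltx.
  have := pF c1' v (x :: c2); rewrite -cat_rcons => /(_ Ec rv)/andP[-> le].
  exact: leq_trans le _.
have yin : y \in ys.
  (* The leaves of [c1] split into the done ones, which form [D], and live ones. *)
  apply/mem_sums; exists (base st), [seq j <- others (ev_leaf e) (live st) | j \in unzip1 c1].
  split; rewrite ?inE ?filter_subseq // bD -wsum_cat; apply: perm_wsum.
  have uc1 : uniq (unzip1 c1) by move: uc; rewrite Ec /unzip1 map_cat cat_uniq => /and3P[].
  have nx : x.1 \notin unzip1 c1.
    move: uc; rewrite Ec /unzip1 map_cat cat_uniq => /and3P[_ /hasPn/(_ x.1) H _].
    by apply: H; rewrite mem_head.
  (* The visit of a done leaf ends by the current time. It is not [x], whose leaf is not done, and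
     visits after [x] end later. *)
  have Dc1 j : j \in D -> j \in unzip1 c1.
    move=> jD; have := jD; rewrite DE => /hasP[e' pe' /andP[/eqP l' /eqP r']].
    have ein' : e' \in evs by rewrite -mem_ord E mem_cat pe'.
    have : j \in unzip1 c by apply: c_full; case/mem_events: ein'; rewrite l'.
    case/mapP=> v vc jv.
    have [e2 ein2 [l2 _ t2]] := visit_event vc; rewrite mem_ord in ein2.
    have le1 := event_last ein2 ein'; rewrite l' l2 t2 in le1.
    have {}le1 := le1 jv r'; have le2 := ord_pre E pe'.
    move: (vc); rewrite {1}Ec mem_cat inE => /or3P[vc1|/eqP vx|vc2].
    - by rewrite jv; apply: map_f.
    - by move: nd; rewrite lx -vx -jv -DE jD.
    - have := bc2 v vc2; have h1 := valid_lt sorted_tss (mem_c_valid vc).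
      rewrite /before -tx => h2; have := leq_ltn_trans (leq_trans le1 le2) (ltn_trans h2 h1).
      by rewrite ltnn.
  apply: uniq_perm => //.
    rewrite cat_uniq uD !filter_uniq // andbT; apply/hasPn => j.
    by rewrite !mem_filter alE DE => /and3P[_ _ /andP[]].
  move=> j; rewrite mem_cat !mem_filter alE DE lx.
  apply/idP/idP => [jc1|/orP[|/andP[-> //]]]; last by rewrite -DE => /Dc1.
  rewrite jc1 /=; case: (done pre j) => //=; rewrite andbT; apply/andP; split.
    by apply: contraNneq nx => <-.
  case/mapP: jc1 => v vc1 ->; have: reached pre v.
    by apply: (reached_before E); rewrite ?c1c // tx; apply: ltn_trans (c1x v vc1) ltx.
  by case/hasP=> e' pe' /andP[le' _]; apply/hasP; exists e'.
rewrite /unzip1 map_rcons wsum_rcons -/(unzip1 c1) -/y -lx.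
have ne : F (y + 2 ^ ev_leaf e) != 0.
  by apply: settle_hit => //; case/andP: Fy; rewrite ?lt0n.
rewrite lt0n ne /=; have [|[e' + ->]] := bF' (y + 2 ^ ev_leaf e); first by move/leq_trans; apply.
by rewrite mem_rcons inE -tx => /orP[/eqP-> //|/(ord_pre E)].
Qed.

Lemma complete_run : tab (run ord) (2 ^ size tss).-1 != 0.
Proof.
have H pre post : ord = pre ++ post ->
    [/\ exact_sets pre (base (run pre)) (live (run pre)),
        progress pre (tab (run pre)) & tab_bound pre (tab (run pre))].
  elim/last_ind: pre post => [|pre e IHpre] post E.
    split.
    - by exists [::]; rewrite /= /wsum big_nil.
    - by split.
    - by move=> y; left=> /=; case: eqP.
  rewrite cat_rcons in E; have [ss sp st] := IHpre _ E.
  rewrite /run foldl_rcons; have [? ?] := progress_step E ss sp st.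
  by split=> //; apply: exact_step E ss.
have [_ [F0 pF] _] := H ord [::] (esym (cats0 _)).
have -> : (2 ^ size tss).-1 = wsum (unzip1 c).
  rewrite -wsum_iota; apply: perm_wsum; apply: uniq_perm; rewrite ?iota_uniq //.
    by case/and3P: c_sched.
  move=> i; rewrite mem_iota add0n /=; apply/idP/idP => [/c_full //|].
  by case/mapP=> v /mem_c_valid/valid_mem[/nth_tss_size lt _] ->.
(* The empty schedule is answered by the initial entry at code 0. *)
have [->|[c1 [x Ec]]] : c = [::] \/ exists c1 x, c = rcons c1 x.
- by case/lastP: (c) => [|c1 x]; [left|right; exists c1, x].
- by rewrite /wsum big_nil F0.
rewrite Ec -lt0n.
have xc : x \in c by rewrite Ec mem_rcons mem_head.
have [e ein [e1 _ e3]] := visit_event xc.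
have rx : reached ord x by apply/hasP; exists e => //; rewrite e1 e3 !eqxx.
by have := pF c1 x [::]; rewrite cats1 => /(_ Ec rx)/andP[].
Qed.

End Complete.

Theorem run_complete : schedulable tss -> tab (run ord) (2 ^ size tss).-1 != 0.
Proof. by case=> c cs cf; apply: complete_run cf. Qed.

End Correctness.

(** * Timed weakest preconditions *)

Definition wp p s (Q : nat -> store -> Prop) :=
  exists T s', exec p s T s' /\ Q T s'.

(** Symbolic execution with exact cost; a loop is left as a [wp] goal, to be settled by an
    invariant. *)
Fixpoint vc p s (Q : nat -> store -> Prop) : Prop :=
  match p with
  | Skip => Q 1 s
  | Put a e1 e2 => Q (cost e1 + cost e2).+1 (update s a (eval s e1) (eval s e2))
  | Seq p q => vc p s (fun T s' => vc q s' (fun T' s'' => Q (T + T') s''))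
  | If e p q => if eval s e != 0 then vc p s (fun T s' => Q (cost e + T).+1 s')
                else vc q s (fun T s' => Q (cost e + T).+1 s')
  | While _ _ => wp p s Q
  end.

Lemma wp_conseq p s (Q Q' : nat -> store -> Prop) :
  wp p s Q -> (forall T s', Q T s' -> Q' T s') -> wp p s Q'.
Proof. by move=> [T [s' [ex q]]] QQ'; exists T, s'; split=> //; apply: QQ'. Qed.

Lemma vc_wp p s Q : vc p s Q -> wp p s Q.
Proof.
elim: p s Q => [|a e1 e2|p IHp q IHq|e p IHp q IHq|e p IHp] s Q //=.
- by move=> q; exists 1, s; split=> //; constructor.
- by move=> q; do 2!eexists; split; first by constructor.
- move/IHp=> [T [s' [ex /IHq[T' [s'' [ex' q']]]]]].
  by exists (T + T'), s''; split=> //; apply: ExecSeq ex ex'.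
- case: ifP => [ne /IHp|/negbFE/eqP e0 /IHq] [T [s' [ex q']]].
    by exists (cost e + T).+1, s'; split=> //; apply: ExecIfT.
  by exists (cost e + T).+1, s'; split=> //; apply: ExecIfF.
Qed.

Lemma vc_of_wp p s Q : wp p s Q -> vc p s Q.
Proof.
case=> T [s' [ex]]; elim: ex Q => {p s T s'} //=.
- by move=> p q s T s' T' s'' _ IHp _ IHq Q q''; apply: IHp; apply: IHq.
- by move=> e p q s T s' -> _ IHp Q q'; apply: IHp.
- by move=> e p q s T s' -> _ IHq Q q'; apply: IHq.
- move=> e p s T s' T' s'' ne ex1 _ ex2 _ Q q''.
  by exists (cost e + T + T').+1, s''; split=> //; apply: ExecWhileT ex1 ex2.
- by move=> e p s e0 Q q'; exists (cost e).+1, s; split=> //; apply: ExecWhileF.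
Qed.

Lemma vc_seq p q s Q :
  vc p s (fun T s' => vc q s' (fun T' s'' => Q (T + T') s'')) -> vc (Seq p q) s Q.
Proof. by []. Qed.

Lemma wp_whileF e p s (Q : nat -> store -> Prop) :
  eval s e = 0 -> Q (cost e).+1 s -> wp (While e p) s Q.
Proof. by move=> e0 q; exists (cost e).+1, s; split=> //; apply: ExecWhileF. Qed.

Lemma wp_whileT e p s (Q : nat -> store -> Prop) : eval s e != 0 ->
  vc p s (fun T s' => wp (While e p) s' (fun T' s'' => Q (cost e + T + T').+1 s'')) ->
  wp (While e p) s Q.
Proof.
move=> ne /vc_wp[T [s' [ex [T' [s'' [ex' q]]]]]].
by exists (cost e + T + T').+1, s''; split=> //; apply: ExecWhileT ex ex'.
Qed.

Lemma updE s a i v b j :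
  update s a i v b j = if (b == a) && (j == i) then v else s b j.
Proof. by []. Qed.

Definition frame (l : seq nat) (s s' : store) := forall a, a \notin l -> s' a = s a.

Lemma frame_refl l s : frame l s s.
Proof. by []. Qed.

Lemma frame_trans l s1 s2 s3 : frame l s1 s2 -> frame l s2 s3 -> frame l s1 s3.
Proof. by move=> f12 f23 a al; rewrite f23 ?f12. Qed.

Lemma frame_sub l l' s s' : {subset l <= l'} -> frame l s s' -> frame l' s s'.
Proof. by move=> ll' f a al; apply: f; apply: contra al => /ll'. Qed.

Lemma frame_put l s s' a i v : a \in l -> frame l s s' -> frame l s (update s' a i v).
Proof.
move=> al f b bl; rewrite /update -f //.
by case: eqP => // ba; rewrite ba al in bl.
Qed.

Ltac frame_solve :=
  lazymatch goal with
  | |- frame _ ?s ?s => exact: frame_refl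
  | |- frame _ _ (update _ _ _ _) => apply: frame_put; [by []|frame_solve]
  | H : frame ?l ?s1 ?s2 |- frame _ _ ?s2 =>
      apply: (@frame_trans _ _ s1); [frame_solve|apply: (frame_sub _ H); by apply/allP]
  end.

(** * The program *)

Notation var a := (Get a (Cst 0)).
Notation "a ':::=' e" := (Put a (Cst 0) e) (at level 65).
Infix "[+]" := Defs.Add (at level 50, left associativity).
Infix "[-]" := Defs.Sub (at level 50, left associativity).
Notation "p ;;; q" := (Seq p q) (at level 70, right associativity).

Notation aIN := 0.
Notation aANS := 1.
Notation vTodo := 2.  (* leaves still to be read *)
Notation vPtr := 3.
Notation vW := 4.     (* the code [2 ^ i] of the current leaf *)
Notation vCnt := 5.   (* times of the current leaf still to be read *)
Notation vFst := 6.
Notation vPrev := 7.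
Notation vT := 8.
Notation vEv := 9.    (* number of events *)
Notation vL := 10.    (* smallest gap, 0 if there is none *)
Notation vB := 11.    (* largest difference of two times of a leaf *)
Notation vM := 12.    (* one more than the largest time *)
Notation vLeaf := 13. (* number of leaves read *)
Notation vBad := 14.
Notation vBase := 15.
Notation vLive := 16. (* number of live leaves, times [vL] *)
Notation vE := 17.
Notation vI := 18.
Notation vJ := 19.
Notation vLen := 20.
Notation vX := 21.
Notation vY := 22.
Notation aEvW := 30.
Notation aEvP := 31.
Notation aEvR := 32.
Notation aEvN := 33.
Notation aHead := 34.
Notation aLive := 35. (* the live leaves, at the multiples of [vL] *)
Notation aSums := 36.
Notation aTab := 37.

Definition shrink_gap : prog :=
  If (var vPrev)
    (vX :::= var vT [+] Cst 1 [-] var vPrev ;;;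
     If (var vL) (If (var vL [-] var vX) (vL :::= var vX) Skip) (vL :::= var vX))
    Skip.

Definition raise a b : prog := If (var b [-] var a) (a :::= var b) Skip.

(** Events are numbered from 1, so 0 ends a list. Putting each event at the head of the list of its
    time sorts the events into buckets. *)
Definition read_time : prog :=
  vT :::= Get aIN (var vPtr) ;;;
  vPtr :::= var vPtr [+] Cst 1 ;;;
  vCnt :::= var vCnt [-] Cst 1 ;;;
  vEv :::= var vEv [+] Cst 1 ;;;
  Put aEvW (var vEv) (var vW) ;;;
  Put aEvP (var vEv) (var vPrev) ;;;
  Put aEvR (var vEv) (var vCnt) ;;;
  Put aEvN (var vEv) (Get aHead (var vT)) ;;;
  Put aHead (var vT) (var vEv) ;;;
  shrink_gap ;;;
  vPrev :::= var vT [+] Cst 1.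

Definition read_times : prog := While (var vCnt) read_time.

Definition reject : prog := vTodo :::= Cst 0 ;;; vBad :::= Cst 1.

Definition read_leaf : prog :=
  vCnt :::= Get aIN (var vPtr) ;;;
  vPtr :::= var vPtr [+] Cst 1 ;;;
  If (var vCnt [-] Cst 1)
    (vFst :::= Get aIN (var vPtr) ;;;
     vPrev :::= Cst 0 ;;;
     read_times ;;;
     vX :::= var vPrev [-] Cst 1 [-] var vFst ;;;
     raise vB vX ;;;
     raise vM vPrev ;;;
     vW :::= var vW [+] var vW ;;;
     vLeaf :::= var vLeaf [+] Cst 1 ;;;
     vTodo :::= var vTodo [-] Cst 1 ;;;
     If (var vM [-] var vLeaf) Skip reject)
    reject.

Definition read_leaves : prog := While (var vTodo) read_leaf.

Definition double_sums : prog :=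
  While (var vLen [-] var vX)
    (Put aSums (var vLen [+] var vX) (Get aSums (var vX) [+] var vY) ;;;
     vX :::= var vX [+] Cst 1).

(** Strides of [vL] keep [vLive] equal to the number of live leaves times the smallest gap, so the
    capacity test is made with additions alone. The live list is compacted in place without the
    current leaf; two codes differ iff the sum of both truncated differences is nonzero. *)
Definition collect : prog :=
  While (var vLive [-] var vI)
    (vY :::= Get aLive (var vI) ;;;
     If ((var vY [-] Get aEvW (var vE)) [+] (Get aEvW (var vE) [-] var vY))
       (Put aLive (var vJ) (var vY) ;;;
        vJ :::= var vJ [+] var vL ;;;
        vX :::= Cst 0 ;;;
        double_sums ;;;
        vLen :::= var vLen [+] var vLen)
       Skip ;;;
     vI :::= var vI [+] var vL).

Definition settle_all : prog :=
  While (var vLen [-] var vX)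
    (vY :::= Get aSums (var vX) ;;;
     If (Get aTab (var vY))
       (If (Get aTab (var vY) [-] Get aEvP (var vE)) Skip
         (If (Get aTab (var vY [+] Get aEvW (var vE))) Skip
            (Put aTab (var vY [+] Get aEvW (var vE)) (var vT [+] Cst 2))))
       Skip ;;;
     vX :::= var vX [+] Cst 1).

Definition process_event : prog :=
  If (var vLive [-] (var vB [+] var vB)) Skip
    (vI :::= Cst 0 ;;;
     vJ :::= Cst 0 ;;;
     vLen :::= Cst 1 ;;;
     Put aSums (Cst 0) (var vBase) ;;;
     collect ;;;
     vX :::= Cst 0 ;;;
     settle_all ;;;
     If (Get aEvR (var vE))
       (Put aLive (var vJ) (Get aEvW (var vE)) ;;;
        vLive :::= var vJ [+] var vL)
       (vBase :::= var vBase [+] Get aEvW (var vE) ;;;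
        vLive :::= var vJ)).

Definition process_bucket : prog :=
  While (var vE) (process_event ;;; vE :::= Get aEvN (var vE)).

Definition process_all : prog :=
  While (var vM [-] var vT)
    (vE :::= Get aHead (var vT) ;;;
     process_bucket ;;;
     vT :::= var vT [+] Cst 1).

(** After all leaves are read [vW] is [2 ^ n], so [vW - 1] is the code of the full set. *)
Definition explore : prog :=
  vTodo :::= Get aIN (Cst 0) ;;;
  vPtr :::= Cst 1 ;;;
  vW :::= Cst 1 ;;;
  read_leaves ;;;
  If (var vBad) Skip
    (Put aTab (Cst 0) (Cst 1) ;;;
     vT :::= Cst 0 ;;;
     process_all ;;;
     aANS :::= Get aTab (var vW [-] Cst 1)).

(** * Simulation of the dynamic program *)

Definition holds (s : store) (a : nat) (l : seq nat) :=
  forall j, j < size l -> s a j = nth 0 l j.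

Lemma double_sumsP s E y :
  s vLen 0 = size E -> s vY 0 = y -> s vX 0 = 0 -> holds s aSums E ->
  wp double_sums s (fun T s' => [/\ T <= 30 * size E + 6,
    frame [:: vX; aSums] s s' & holds s' aSums (extend E y)]).
Proof.
move=> sL sY.
suff H d : forall s x, x + d = size E -> s vLen 0 = size E -> s vY 0 = y ->
    s vX 0 = x -> holds s aSums (E ++ take x [seq z + y | z <- E]) ->
    wp double_sums s (fun T s' => [/\ T <= 30 * d + 6,
      frame [:: vX; aSums] s s' & holds s' aSums (extend E y)]).
  by move=> s0 sE; apply: (H (size E) s 0); rewrite // take0 cats0.
elim: d {s sL sY} => [|d IHd] s x xd sL sY sX sE.
  apply: wp_whileF => /=; first by rewrite sL sX; lia.
  split=> //; move: sE; rewrite take_oversize // size_map; lia.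
apply: wp_whileT => /=; first by rewrite sL sX; lia.
apply: wp_conseq (IHd _ x.+1 _ _ _ _ _) _; rewrite ?updE /= ?sX ?sL ?sY ?addn1 //.
- lia.
- have xlt : x < size E by lia.
  have sz : size (take x [seq z + y | z <- E]) = x.
    by rewrite size_take size_map xlt.
  move=> j; rewrite (take_nth 0) ?size_map // -rcons_cat size_rcons nth_rcons size_cat sz.
  rewrite ltnS leq_eqVlt !updE /=.
  case: (j =P size E + x) => [->|/eqP ne] /=.
    by rewrite ltnn (nth_map 0) // sE ?size_cat ?sz; [rewrite nth_cat xlt|lia].
  by move=> lt; rewrite lt; apply: sE; rewrite size_cat sz.
move=> T s' [leT fr hs]; split=> //; first by lia.
by frame_solve.
Qed.

Section Simulation.
Variable L : nat.
Hypothesis L_gt0 : 0 < L.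

(** Here [al1] is scanned and [al2] is not. The number of subset sums serves as a potential: a
    doubling costs a multiple of the current number, which is also its growth, so the total is
    linear in the final number. *)
Lemma collectP s i b al1 al2 :
  let S al := sums [:: b] [seq 2 ^ j | j <- others i al] in
  let al := al1 ++ al2 in
  s vL 0 = L -> s vLive 0 = size al * L -> s aEvW (s vE 0) = 2 ^ i ->
  s vI 0 = size al1 * L -> s vJ 0 = size (others i al1) * L ->
  (forall q, q < size (others i al1) -> s aLive (q * L) = 2 ^ nth 0 (others i al1) q) ->
  (forall q, q < size al2 -> s aLive ((size al1 + q) * L) = 2 ^ nth 0 al2 q) ->
  s vLen 0 = size (S al1) -> holds s aSums (S al1) ->
  wp collect s (fun T s' =>
    [/\ T + 30 * size (S al1) <= 100 * size al2 + 30 * size (S al) + 10,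
        frame [:: vY; aLive; vJ; vX; aSums; vLen; vI] s s',
        s' vJ 0 = size (others i al) * L /\
        (forall q, q < size (others i al) -> s' aLive (q * L) = 2 ^ nth 0 (others i al) q)
      & s' vLen 0 = size (S al) /\ holds s' aSums (S al)]).
Proof.
move=> S al; elim: al2 al1 @al s => [|j al2 IHal2] al1 al s.
  rewrite /al cats0 => sL sV sW sI sJ h1 h2 sN hs.
  apply: wp_whileF => /=; first by rewrite sV sI subnn.
  split=> //; lia.
move=> sL sV sW sI sJ h1 h2 sN hs.
have Eal : al = rcons al1 j ++ al2 by rewrite cat_rcons.
have e0 : s aLive (size al1 * L) = 2 ^ j by rewrite -(h2 0) // addn0.
apply: wp_whileT => /=.
  by rewrite sV sI -mulnBl /al size_cat addKn muln_eq0 negb_or -!lt0n L_gt0.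
rewrite ?updE /= sI e0 sW.
have neq : (2 ^ j - 2 ^ i + (2 ^ i - 2 ^ j) != 0) = (j != i).
  by rewrite -(eqn_exp2l j i (isT : 1 < 2)); lia.
rewrite neq; case: ifP => ji; last first.
  have oE : others i (rcons al1 j) = others i al1 by rewrite /others filter_rcons ji.
  have SE : S (rcons al1 j) = S al1 by rewrite /S oE.
  apply: wp_conseq (IHal2 (rcons al1 j) _ _ _ _ _ _ _ _ _ _) _;
    rewrite ?updE /= ?oE ?SE ?size_rcons -?Eal //.
  - by rewrite sL; lia.
  - move=> q lq; rewrite addSnnS; exact: (h2 q.+1).
  - move=> T s' [leT fr hJ hN]; split=> //; first by lia.
    by frame_solve.
have oE : others i (rcons al1 j) = rcons (others i al1) j by rewrite /others filter_rcons ji.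
have SE : S (rcons al1 j) = extend (S al1) (2 ^ j).
  by rewrite /S oE map_rcons /sums foldl_rcons.
(* In the compaction, writing never overtakes reading. *)
have le1 : size (others i al1) <= size al1 by rewrite size_filter count_size.
apply: wp_conseq (double_sumsP (E := S al1) (y := 2 ^ j) _ _ _ _) _ => //.
move=> T s1 [leT fr hs1].
have g a : a \notin [:: vX; aSums] -> s1 a = _ := fr a.
apply: wp_conseq (IHal2 (rcons al1 j) _ _ _ _ _ _ _ _ _ _) _;
  rewrite ?updE /= ?oE ?SE ?size_rcons -?Eal ?g //=.
- by rewrite ?updE /= sL sI; lia.
- by rewrite ?updE /= sL sJ mulSnr.
- move=> q; rewrite !updE /= g // !updE /= ltnS leq_eqVlt sJ nth_rcons eqn_pmul2r //.
  case: eqP => [->|ne] /=; first by rewrite ltnn.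
  by move=> lq; rewrite lq; apply: h1.
- move=> q lq; rewrite !updE /= g // !updE /= sJ eqn_pmul2r // addSnnS gtn_eqF; last by lia.
  exact: (h2 q.+1).
- by rewrite ?updE /= sN size_extend addnn.
- move=> T' s' [leT' fr' hJ hN]; split=> //; last by frame_solve.
  by move: leT'; rewrite size_extend; lia.
Qed.

End Simulation.

Lemma settle_allP s ys w p t :
  s vLen 0 = size ys -> s vX 0 = 0 -> holds s aSums ys ->
  s aEvW (s vE 0) = w -> s aEvP (s vE 0) = p -> s vT 0 = t ->
  wp settle_all s (fun T s' => [/\ T <= 100 * size ys + 10,
    frame [:: vX; vY; aTab] s s' & s' aTab = foldl (settle w p t.+2) (s aTab) ys]).
Proof.
move=> sN s0 hs sW sP sT.
suff H d : forall s x, x + d = size ys -> s vLen 0 = size ys -> s vX 0 = x -> holds s aSums ys ->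
    s aEvW (s vE 0) = w -> s aEvP (s vE 0) = p -> s vT 0 = t ->
    wp settle_all s (fun T s' => [/\ T <= 100 * d + 10,
      frame [:: vX; vY; aTab] s s' & s' aTab = foldl (settle w p t.+2) (s aTab) (drop x ys)]).
  by have := H (size ys) s 0; rewrite drop0; apply.
elim: d {s sN s0 hs sW sP sT} => [|d IHd] s x xd sN sX hs sW sP sT.
  apply: wp_whileF => /=; first by rewrite sN sX; lia.
  by split=> //; rewrite drop_oversize //; lia.
apply: wp_whileT => /=; first by rewrite sN sX; lia.
have xlt : x < size ys by lia.
rewrite ?updE /= sX hs // sW sP (drop_nth 0 xlt) /=.
set y := nth 0 ys x.
have E : settle w p t.+2 (s aTab) y = if s aTab y != 0 then
    if s aTab y - p != 0 then s aTab else if s aTab (y + w) != 0 then s aTab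
    else (fun z => if z == y + w then t.+2 else s aTab z) else s aTab.
  rewrite /settle; case: (s aTab y != 0) => //=; rewrite subn_eq0.
  by case: (_ <= p) => //=; case: (_ == 0).
rewrite E.
have fin s1 : s1 vLen = s vLen -> s1 vX 0 = x.+1 -> s1 aSums = s aSums -> s1 aEvW = s aEvW ->
    s1 aEvP = s aEvP -> s1 vE = s vE -> s1 vT = s vT -> frame [:: vX; vY; aTab] s s1 ->
    wp settle_all s1 (fun T s' => [/\ T <= 100 * d + 10, frame [:: vX; vY; aTab] s s' &
      s' aTab = foldl (settle w p t.+2) (s1 aTab) (drop x.+1 ys)]).
  move=> e1 e2 e3 e4 e5 e6 e7 fr.
  apply: wp_conseq (IHd s1 x.+1 _ _ _ _ _ _ _) _; rewrite ?e1 ?e4 ?e5 ?e6 ?e7 //; first lia.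
    by move=> j /hs; rewrite e3.
  move=> T s' [leT fr' ->]; split=> //; exact: frame_trans fr fr'.
case: ifP => c1; [case: ifP => c2; [|case: ifP => c3]|];
  (apply: wp_conseq (fin _ _ _ _ _ _ _ _ _) _;
    [..|move=> T s' [leT fr ->]; split=> //; first lia]) => //=;
  rewrite ?addn1 //; try frame_solve.
- by rewrite c1 c2.
- by rewrite c1 c2 c3.
- by rewrite c1 c2 c3 sT addn2.
- by rewrite c1.
Qed.

Lemma size_sums E ws : size (sums E ws) = size E * 2 ^ size ws.
Proof.
elim: ws E => [|w ws IHws] E; first by rewrite muln1.
by rewrite -[sums _ _]/(sums (extend E w) ws) IHws size_extend /= expnS -mul2n; lia.
Qed.

Definition simulates (L B : nat) (s : store) (st : dp) :=
  [/\ s vL 0 = L, s vB 0 = B, s vBase 0 = base st, s aTab = tab st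
    & s vLive 0 = size (live st) * L /\
      forall q, q < size (live st) -> s aLive (q * L) = 2 ^ nth 0 (live st) q].

Definition stored (s : store) (h : nat) (e : event) :=
  [/\ s aEvW h = 2 ^ ev_leaf e, s aEvP h = ev_from e & s aEvR h = ev_rem e].

Notation work := [:: vI; vJ; vLen; aSums; vY; aLive; vX; aTab; vBase; vLive].

(** * Simulation of the sweep, with [Z] bounding the number of candidate sets *)

Section Sweep.
Variables (L B Z : nat).
Hypothesis L_gt0 : 0 < L.
Hypothesis Z_gt0 : 0 < Z.
Hypothesis Z_ge : forall m, m * L <= B.*2 -> 2 ^ m <= Z.

Lemma process_eventP s st e :
  simulates L B s st -> stored s (s vE 0) e -> s vT 0 = ev_time e ->
  wp process_event s (fun T s' => [/\ T <= 400 * Z, frame work s s'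
    & simulates L B s' (step L B st e)]).
Proof.
move=> [sL sB sS sF [sV hV]] [sW sP sR] sT.
apply: vc_wp => /=; rewrite sV sB addnn subn_eq0 /step.
case: (leqP (size (live st) * L) B.*2) => /= cap; last first.
  by split=> //; lia.
set i := ev_leaf e in sW *; set al := others i (live st).
set ys := sums _ _.
have szys : size ys = 2 ^ size al by rewrite size_sums size_map mul1n.
have szal : size al <= size (live st) by rewrite size_filter count_size.
(* Both loops have length at most [Z]: with [m] live leaves there are at most [2 ^ m] candidates,
   and [m < 2 ^ m]. *)
have ysZ : size ys <= Z.
  by rewrite szys; apply: leq_trans (Z_ge cap); rewrite leq_exp2l.
have lvZ : size (live st) <= Z.
  by apply: leq_trans (Z_ge cap); rewrite ltnW // ltn_expl.
apply: wp_conseq (@collectP L L_gt0 _ i (base st) [::] (live st) _ _ _ _ _ _ _ _ _) _ => //.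
- by rewrite updE /=; case=> // _; rewrite updE.
move=> T s1 [leT fr1 [sJ hJ] [sN hN]]; rewrite -/ys in leT sN hN.
have g1 a : a \notin [:: vY; aLive; vJ; vX; aSums; vLen; vI] -> s1 a = _ := fr1 a.
apply: wp_conseq (@settle_allP _ ys (2 ^ i) (ev_from e) (ev_time e) _ _ _ _ _ _) _ => //;
  rewrite ?updE /= ?g1 //.
move=> T' s2 [leT' fr2 tab2].
have g2 a : a \notin [:: vX; vY; aTab] -> s2 a = _ := fr2 a.
have tabE : s2 aTab = foldl (settle (2 ^ i) (ev_from e) (ev_time e).+2) (tab st) ys.
  by rewrite tab2 -[update _ _ _ _ aTab]/(s1 aTab) g1 // -sF.
have eE h : (h \in [:: aEvW; aEvP; aEvR; vE; vL; vB; vBase]) -> s2 h = s h.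
  by rewrite !inE => /or4P[/eqP->|/eqP->|/eqP->|/or4P[]/eqP->]; rewrite g2 // /update /= g1.
rewrite (eE aEvR) // (eE vE) // sR; case: ifP => r0; rewrite r0 /=.
  split.
  - by lia.
  - by frame_solve.
  split; [by rewrite !updE /= eE|by rewrite !updE /= eE|by rewrite !updE /= eE|exact: tabE|].
  split=> [|q]; first by rewrite !updE /= g2 // updE /= sJ eE // sL size_rcons mulSnr.
  rewrite !updE /= (g2 vJ) // (g2 aLive) // !updE /= size_rcons ltnS leq_eqVlt sJ nth_rcons.
  rewrite eqn_pmul2r //; case: eqP => [->|ne] /=; first by rewrite ltnn eE.
  by move=> lq; rewrite lq; apply: hJ.
split.
- by lia.
- by frame_solve.
split; [by rewrite !updE /= eE|by rewrite !updE /= eE| |exact: tabE|].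
  by rewrite !updE /= !eE // sS sW.
by split=> [|q lq]; rewrite !updE /= g2 // updE /= ?sJ ?hJ.
Qed.

(** The bound [N] on the indices in use ensures that storing a new event at [N.+1] leaves the list
    intact. *)
Fixpoint linked (s : store) (N h : nat) (es : seq event) : Prop :=
  if es is e :: es' then
    [/\ 0 < h <= N, stored s h e & linked s N (s aEvN h) es']
  else h = 0.

Lemma linked_eq s s' N h es :
  (forall a j, a \in [:: aEvW; aEvP; aEvR; aEvN] -> j <= N -> s' a j = s a j) ->
  linked s N h es -> linked s' N h es.
Proof.
move=> E; elim: es h => //= e es IHes h [hN [e1 e2 e3] ln]; split=> //.
  by case/andP: hN => _ hN; split; rewrite E.
by rewrite E //; [apply: IHes|case/andP: hN].
Qed.

Lemma process_bucketP s st es N :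
  simulates L B s st -> linked s N (s vE 0) es ->
  all (fun e => ev_time e == s vT 0) es ->
  wp process_bucket s (fun T s' => [/\ T <= 410 * Z * size es + 3,
    frame (vE :: work) s s' & simulates L B s' (foldl (step L B) st es)]).
Proof.
elim: es s st => [|e es IHes] s st sim /=.
  by move=> sE _; apply: wp_whileF => //=; split=> //; lia.
move=> [/andP[h0 hN] st_e ln] /andP[/eqP te ts].
apply: wp_whileT; first by rewrite /= -lt0n.
apply: vc_seq; apply: vc_of_wp.
apply: wp_conseq (process_eventP sim st_e (esym te)) _ => T s1 [leT fr1 sim1] /=.
have g1 a : a \notin work -> s1 a = _ := fr1 a.
apply: wp_conseq (IHes _ _ _ _ _) _ => //.
- exact: sim1.
- rewrite !updE /= !g1 //; apply: linked_eq ln => a j.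
  by rewrite !inE => /or4P[]/eqP-> _; rewrite updE /= g1.
- by rewrite updE /= g1.
move=> T' s2 [leT' fr2 sim2]; split=> //; last by frame_solve.
by rewrite /=; lia.
Qed.

Lemma process_allP s evs N M :
  s vM 0 = M -> s vT 0 = 0 -> simulates L B s dp0 ->
  (forall t, linked s N (s aHead t) (bucket t evs)) ->
  wp process_all s (fun T s' => [/\ T <= 410 * Z * size (sweep M evs) + 40 * M + 10,
    s' vW = s vW & simulates L B s' (foldl (step L B) dp0 (sweep M evs))]).
Proof.
move=> sM sT sim ln.
suff H d : forall s t, t + d = M -> s vM 0 = M -> s vT 0 = t ->
    simulates L B s (foldl (step L B) dp0 (sweep t evs)) ->
    (forall t, linked s N (s aHead t) (bucket t evs)) ->
    wp process_all s (fun T s' =>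
      [/\ T + 410 * Z * size (sweep t evs) <= 410 * Z * size (sweep M evs) + 40 * d + 10,
       s' vW = s vW & simulates L B s' (foldl (step L B) dp0 (sweep M evs))]).
  by apply: wp_conseq (H M s 0 _ _ _ _ _) _ => // T s' [leT ? ?]; split=> //; lia.
elim: d {s sM sT sim ln} => [|d IHd] s t td sM sT sim ln.
  have {}td : t = M by lia.
  rewrite td in sT sim *.
  apply: wp_whileF; first by rewrite /= sM sT subnn.
  by split=> //=; lia.
apply: wp_whileT => /=; first by rewrite sM sT; lia.
apply: wp_conseq (@process_bucketP _ _ (bucket t evs) N _ _ _) _ => //.
- exact: sim.
- rewrite updE /= sT; apply: linked_eq (ln t) => a j.
  by rewrite !inE => /or4P[]/eqP->.
- by apply/allP => e; rewrite mem_bucket updE /= sT => /andP[].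
move=> T s1 [leT fr1 sim1].
have g1 a : a \notin vE :: work -> s1 a = _ := fr1 a.
apply: wp_conseq (IHd _ t.+1 _ _ _ _ _) _ => //.
- by lia.
- by rewrite updE /= g1.
- by rewrite !updE /= g1 // updE /= sT addn1.
- by rewrite sweepS foldl_cat.
- move=> t'; rewrite updE /= (g1 aHead) //; apply: linked_eq (ln t') => a j.
  by rewrite !inE => /or4P[]/eqP-> _; rewrite updE /= g1.
move=> T' s2 [leT' w2 sim2]; split=> //; last first.
  by rewrite w2 -[RHS]/(update s vE 0 (s aHead (s vT 0)) vW) -g1.
by move: leT' leT; rewrite sweepS size_cat; lia.
Qed.

End Sweep.

(** * Reading the input *)

Lemma vc_raise a b s (Q : nat -> store -> Prop) :
  (forall T s', T <= 12 -> frame [:: a] s s' ->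
     s' a 0 = maxn (s a 0) (s b 0) -> Q T s') -> vc (raise a b) s Q.
Proof.
move=> H; rewrite /raise /= subn_eq0.
case: leqP => le /=; apply: H => //.
- by rewrite (maxn_idPl le).
- by apply: frame_put; rewrite ?mem_head.
- by rewrite updE !eqxx /= (maxn_idPr (ltnW le)).
Qed.

Definition shrunk_gap (p t L : nat) :=
  if p == 0 then L else
  if (L == 0) || (t.+1 - p < L) then t.+1 - p else L.

Lemma vc_shrink_gap s (Q : nat -> store -> Prop) :
  (forall T s', T <= 40 -> frame [:: vX; vL] s s' ->
     s' vL 0 = shrunk_gap (s vPrev 0) (s vT 0) (s vL 0) -> Q T s') ->
  vc shrink_gap s Q.
Proof.
move=> H; rewrite /shrink_gap /= !updE /= addn1 /shrunk_gap in H *.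
case: (_ == 0) H => H /=; first by apply: H.
rewrite subn_eq0 -ltnNge; case: (_ == 0) H => H /=.
  by apply: H => //; frame_solve.
by case: ltnP H => le H; apply: H => //; frame_solve.
Qed.

Lemma linked_mono s N N' h es : N <= N' -> linked s N h es -> linked s N' h es.
Proof.
move=> NN; elim: es h => //= e es IHes h [/andP[h0 hN] st ln].
by split; [rewrite h0 (leq_trans hN)| |apply: IHes].
Qed.

Lemma bucket_rcons t evs e :
  bucket t (rcons evs e) = if ev_time e == t then e :: bucket t evs else bucket t evs.
Proof. by rewrite /bucket filter_rcons; case: ifP; rewrite ?rev_rcons. Qed.

Definition logged s evs := forall t, linked s (s vEv 0) (s aHead t) (bucket t evs).

(** Positivity is asked only where a pair exists, so the unset value 0 is correct for lists without
    gaps and for no others. *)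
Definition gaps_ge (L : nat) (q : seq nat) :=
  forall a b, infix [:: a; b] q -> 0 < L /\ a + L <= b.

(** The previous time [p.-1] is put back in front, so that the gap to the first unread time is
    counted. *)
Definition since (p : nat) (ts : seq nat) := if p == 0 then ts else p.-1 :: ts.

(** What the reading loop needs to pass one time; the last part says that any later positive minimum
    not above [L1] also covers the gap just read. *)
Lemma gaps_ge_since l p t ts L : 0 < l ->
  gaps_ge l (since p (t :: ts)) ->
  let L1 := shrunk_gap p t L in
  [/\ 0 < L -> 0 < L1 <= L, L = 0 \/ l <= L -> L1 = 0 \/ l <= L1,
      gaps_ge l (t :: ts)
    & forall L', (0 < L1 -> 0 < L' <= L1) -> gaps_ge L' (t :: ts) ->
        gaps_ge L' (since p (t :: ts))].
Proof.
rewrite /since /shrunk_gap => l0; case: p => [|p] gl /=.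
  by split=> // L0; rewrite L0 leqnn.
have [_ pt] : 0 < l /\ p + l <= t by apply: gl; apply/infixP; exists [::], ts.
split.
- by move=> L0; case: ifP; lia.
- by case: ifP; lia.
- by move=> a b ab; apply: gl; rewrite infix_consl ab orbT.
move=> L' HL gL' a b; rewrite infix_consl /= => /orP[|ab]; last exact: gL'.
case/and3P=> /eqP-> /eqP-> _.
by move: HL; case: ifP; lia.
Qed.

Notation read_vars := [:: vT; vPtr; vCnt; vEv; aEvW; aEvP; aEvR; aEvN; aHead; vX; vL; vPrev].

#[local] Arguments update s a i v b j /.
#[local] Opaque shrink_gap raise.

Lemma read_timesP l i ts rest s evs : 0 < l ->
  s vCnt 0 = size ts -> s vW 0 = 2 ^ i ->
  (forall j, s aIN (s vPtr 0 + j) = nth 0 (ts ++ rest) j) ->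
  logged s evs -> gaps_ge l (since (s vPrev 0) ts) -> s vL 0 = 0 \/ l <= s vL 0 ->
  wp read_times s (fun T s' => [/\ T <= 150 * size ts + 3, frame read_vars s s',
    [/\ s' vPtr 0 = s vPtr 0 + size ts, s' vPrev 0 = last (s vPrev 0) (map S ts)
      & logged s' (evs ++ leaf_events i (s vPrev 0) ts)]
    & [/\ 0 < s vL 0 -> 0 < s' vL 0 <= s vL 0, s' vL 0 = 0 \/ l <= s' vL 0
      & gaps_ge (s' vL 0) (since (s vPrev 0) ts)]]).
Proof.
move=> l0; elim: ts s evs => [|t ts IHts] s evs sC sW sIN lg gl sL.
  apply: wp_whileF => //=; split=> //.
    by rewrite addn0 cats0.
  split=> // [|a b]; first lia.
  by rewrite /since; case: ifP => _ /size_infix.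
apply: wp_whileT => /=; first by rewrite sC.
have st : s aIN (s vPtr 0) = t by rewrite -[s vPtr 0]addn0 sIN.
rewrite st sC subn1 /=; apply: vc_shrink_gap => T s1 leT fr1.
set s0 := update _ aHead _ _ in fr1 *.
rewrite ?updE /= => sL1.
have [g1 g2 g3 g4] := gaps_ge_since (s vL 0) l0 gl.
rewrite -sL1 in g1 g2 g4.
have f1 a : a \notin [:: vX; vL] -> s1 a = s0 a := fr1 a.
pose e : event := ((i, s vPrev 0), (t, size ts)).
apply: wp_conseq (IHts _ (rcons evs e) _ _ _ _ _ _) _.
- by rewrite /= f1.
- by rewrite /= f1.
- move=> j; rewrite /= !f1 // /s0 /= -addnA add1n.
  exact: (sIN j.+1).
- move=> t'; rewrite /= !f1 // bucket_rcons /s0 /= !addn1.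
  have old : linked s1 (s vEv 0).+1 (s aHead t') (bucket t' evs).
    apply: (linked_mono (leqnSn _)); apply: linked_eq (lg t') => a j.
    by rewrite !inE => /or4P[]/eqP-> jN; rewrite f1 // /s0 /= !addn1 ltn_eqF.
  have upd h es : linked s1 (s vEv 0).+1 h es ->
      linked (update s1 vPrev 0 t.+1) (s vEv 0).+1 h es.
    by apply: linked_eq => a j; rewrite !inE => /or4P[]/eqP->.
  rewrite [t' == t]eq_sym -[ev_time e]/t; case: eqP => [E|_]; last exact: upd.
  split; first by rewrite /= leqnn.
    by split; rewrite /= f1 // /s0 /= !addn1 eqxx.
  by rewrite /= f1 // /s0 /= !addn1 eqxx; rewrite -E in old *; apply: upd.
- by rewrite /= f1 // /s0 /= !addn1.
- exact: g2.
rewrite /= !(f1 vT, f1 vPtr) // /s0 /= !addn1.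
move=> T' s2 [leT' fr2 [e1 e2 e3] [e4 e5 e6]]; split=> //.
- by lia.
- rewrite /s0 in fr1; frame_solve.
- by split=> //; [rewrite e1; lia|rewrite -cat_rcons].
split=> //.
  by move=> L0; have /andP[a1 a2] := g1 L0; have /andP[-> b2] := e4 a1; exact: leq_trans a2.
by apply: g4.
Qed.

Lemma last_since ts p : last p (map S ts) = if ts is t :: ts' then (last t ts').+1 else p.
Proof. by case: ts => //= t ts; rewrite last_map. Qed.

Lemma sorted_bounds t ts a : sorted ltn (t :: ts) -> a \in t :: ts -> t <= a <= last t ts.
Proof.
elim: ts t a => [|t' ts IHts] t a /=; first by rewrite inE => _ /eqP->; rewrite leqnn.
case/andP=> tt' st; rewrite inE => /orP[/eqP->|/(IHts _ _ st)/andP[h ->]].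
  have /andP[_] := IHts t' t' st (mem_head _ _); rewrite leqnn /=.
  by apply: leq_trans; exact: ltnW.
by rewrite (leq_trans (ltnW tt') h).
Qed.

Lemma gaps_geW L L' q : (0 < L -> 0 < L' <= L) -> gaps_ge L q -> gaps_ge L' q.
Proof. by move=> LL gL a b /gL[/LL]; lia. Qed.

(** * Invariant and cost of reading the leaves *)

Section ReadLeaves.
Variables (tss : seq (seq nat)) (l K U lam : nat) (s0 : store).
Hypothesis l_gt0 : 0 < l.
Hypothesis sorted_tss : forall s, s \in tss -> sorted ltn s.
Hypothesis size_tss : forall s, s \in tss -> size s <= K.
Hypothesis gap_tss : forall s, s \in tss -> gaps_ge l s.
Hypothesis span_tss : forall s a b, s \in tss -> a \in s -> b \in s -> b <= a + U.
Hypothesis time_tss : forall s t, s \in tss -> t \in s -> t <= lam.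

Notation all_read_vars := (read_vars ++ [:: vTodo; vW; vFst; vB; vM; vLeaf; vBad]).

Record reading (r : nat) (s : store) : Prop := Reading {
  rd_frame : frame all_read_vars s0 s;
  rd_todo : s vTodo 0 = size tss - r;
  rd_w : s vW 0 = 2 ^ r;
  rd_leaf : s vLeaf 0 = r;
  rd_bad : s vBad 0 = 0;
  rd_in : forall j, s aIN (s vPtr 0 + j) =
    nth 0 (flatten [seq size x :: x | x <- drop r tss]) j;
  rd_log : logged s (events tss r);
  rd_gap : forall i, i < r -> gaps_ge (s vL 0) (nth [::] tss i);
  rd_gap_min : s vL 0 = 0 \/ l <= s vL 0;
  rd_gap_pos : 0 < r -> 0 < s vL 0;
  rd_span : forall i a b, i < r -> a \in nth [::] tss i -> b \in nth [::] tss i ->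
    b <= a + s vB 0;
  rd_span_max : s vB 0 <= U;
  rd_time : forall i t, i < r -> t \in nth [::] tss i -> t < s vM 0;
  rd_time_max : s vM 0 <= lam.+1;
  rd_time0 : r = 0 -> s vM 0 = 0;
  rd_lam : r <= lam
}.

(** By [rd_lam] at most [lam] leaves are accepted, each at a cost linear in [K]; the extra unit in
    [lam.+1] pays for a rejected leaf. *)
Lemma read_leavesP s r : r <= size tss -> reading r s ->
  wp read_leaves s (fun T s' => T <= (150 * K + 200) * (lam.+1 - r) + 3 /\
    ((s' vBad 0 != 0 /\ frame all_read_vars s0 s' /\ ~ schedulable tss) \/
     reading (size tss) s')).
Proof.
move=> ler rd; have [d Ed] : exists d, r + d = size tss by exists (size tss - r); lia.
elim: d r s {ler} Ed rd => [|d IHd] r s Ed rd.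
  have {}Ed : r = size tss by lia.
  apply: wp_whileF; first by rewrite /= (rd_todo rd); lia.
  by split; [exact: leq_addl|right; rewrite -Ed].
have ltr : r < size tss by lia.
have rlam := rd_lam rd.
have lt1 : 0 < lam.+1 - r by lia.
apply: wp_whileT => /=; first by rewrite (rd_todo rd); lia.
set x := nth [::] tss r.
have xin : x \in tss by apply: mem_nth.
have in0 := rd_in rd; rewrite (drop_nth [::] ltr) /= -/x in in0.
have -> : s aIN (s vPtr 0) = size x by rewrite -[s vPtr 0]addn0 in0.
case: (leqP (size x) 1) => szx.
  rewrite (_ : (size x - 1 != 0) = false); last by lia.
  apply: wp_whileF => //=; split; first by clear -lt1; nia.
  left; split=> //; split; first by have := rd_frame rd => fr; frame_solve.
  by case=> c cs /(_ r ltr)/(valid_size cs); rewrite -/x; lia.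
rewrite (_ : (size x - 1 != 0)); last by lia.
apply: wp_conseq (@read_timesP l r x (flatten [seq size y :: y | y <- drop r.+1 tss]) _
  (events tss r) _ _ _ _ _ _ _) _ => //=.
- exact: rd_w.
- by move=> j; rewrite -addnA add1n in0.
- by move=> t; apply: linked_eq (rd_log rd t) => a j; rewrite !inE => /or4P[]/eqP->.
- exact: gap_tss.
- exact: rd_gap_min rd.
move=> T s1 [leT fr1 [e1 e2 lg1] [gL1 gL2 gL3]].
rewrite /= -eventsS in lg1; rewrite /since /= in gL3.
have f1 a : a \notin read_vars -> s1 a = _ := fr1 a.
apply: vc_raise => T2 s2 leT2 fr2 e3.
have f2 a : a \notin [:: vB] -> s2 a = _ := fr2 a.
apply: vc_raise => T3 s3 leT3 fr3 e4.
have f3 a : a \notin [:: vM] -> s3 a = _ := fr3 a.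
have g a : a \notin [:: vB; vM; vX] -> s3 a = s1 a.
  rewrite !inE !negb_or => /and3P[n1 n2 n3].
  by rewrite f3 ?inE // f2 ?inE // /update (negPf n3).
have h : frame (vB :: vM :: vX :: vFst :: read_vars) s s3 by frame_solve.
have [t [ts Ex]] : exists t ts, x = t :: ts by case: (x) szx => // t ts; exists t, ts.
have xs : sorted ltn (t :: ts) by rewrite -Ex; apply: sorted_tss.
have pv : s1 vPrev 0 = (last t ts).+1 by rewrite e2 last_since Ex.
have sB : s3 vB 0 = maxn (s vB 0) (last t ts - t).
  rewrite f3 // e3 /= pv subn1 /= !f1 //=; congr maxn; congr (_ - _).
  by rewrite (in0 1) Ex.
have sM : s3 vM 0 = maxn (s vM 0) (last t ts).+1.
  by rewrite e4 !f2 //= pv f1.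
have time3 i t' : i < r.+1 -> t' \in nth [::] tss i -> t' < s3 vM 0.
  rewrite sM ltnS leq_eqVlt => /orP[/eqP->|lti tin].
    by rewrite -/x Ex => /(sorted_bounds xs)/andP[_ le]; rewrite leq_max ltnS le orbT.
  by rewrite leq_max (rd_time rd lti tin).
have fr0 := rd_frame rd.
have leK : size x <= K by apply: size_tss.
rewrite (h vLeaf) // (h vTodo) // (h vW) // (rd_leaf rd) (rd_todo rd) (rd_w rd) addn1.
(* On rejection the [r.+1] leaves read have all their times below [vM], which is at most [r.+1]; the
   packing bound excludes a schedule. *)
case: ifP => [ok|/negbFE/eqP bad]; last first.
  apply: wp_whileF => //=; split.
    by clear -leT leT2 leT3 leK lt1; nia.
  left; split=> //; split; first by frame_solve.
  by move=> sch; have := schedulable_time sorted_tss sch ltr time3; lia.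
have le3 : s3 vM 0 <= lam.+1.
  rewrite sM geq_max (rd_time_max rd) ltnS /=; apply: (time_tss xin).
  by rewrite Ex mem_last.
apply: wp_conseq (IHd r.+1 _ _ _) _; first by lia.
  split=> //=.
  - by frame_solve.
  - by lia.
  - by rewrite addnn -mul2n expnS.
  - by rewrite (h vBad) // (rd_bad rd).
  - move=> j; rewrite (h aIN) // (g vPtr) // e1 -!addnA add1n in0 /=.
    by rewrite nth_cat addKn ltnNge leq_addr.
  - move=> t'; rewrite /= (g vEv) // (g aHead) //; apply: linked_eq (lg1 t') => a j.
    by rewrite !inE => /or4P[]/eqP-> _; rewrite /= g.
  - move=> i; rewrite (g vL) // ltnS leq_eqVlt => /orP[/eqP-> //|/(rd_gap rd)].
    exact: gaps_geW.
  - by rewrite (g vL).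
  - rewrite (g vL) // => _; case: (ts) Ex szx => [->//|b ts' Ex' _].
    have [] := gL3 t b; rewrite ?Ex' //.
    by apply/infixP; exists [::], ts'.
  - move=> i a b; rewrite sB ltnS leq_eqVlt => /orP[/eqP->|lti] ain bin.
      move: ain bin; rewrite -/x Ex => /(sorted_bounds xs)/andP[a1 _].
      move=> /(sorted_bounds xs)/andP[_ b1]; apply: (leq_trans b1).
      by move: a1; clear; lia.
    apply: leq_trans (rd_span rd lti ain bin) _; by rewrite leq_add2l leq_maxl.
  - rewrite sB geq_max (rd_span_max rd) /=.
    have := @span_tss _ t (last t ts) xin; rewrite Ex mem_head mem_last => /(_ isT isT).
    by clear; lia.
  - by move: ok; lia.
move=> T' s4 [leT' H]; split=> //.
have E : lam.+1 - r = (lam.+1 - r.+1).+1 by clear -rlam; lia.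
by move: leT'; rewrite E; clear -leT leT2 leT3 leK; nia.
Qed.

End ReadLeaves.

Definition word (tss : seq (seq nat)) : seq nat :=
  size tss :: flatten [seq size x :: x | x <- tss].

(** The number of leaves is absent from the bound because a completed reading forces it to be at
    most [lam]; hence there are at most [lam * K] events, each handled in time linear in [Z]. *)
Lemma exploreP tss l K U lam Z : 0 < l -> 0 < K -> 0 < Z ->
  (forall s, s \in tss -> sorted ltn s) ->
  (forall s, s \in tss -> size s <= K) ->
  (forall s, s \in tss -> gaps_ge l s) ->
  (forall s a b, s \in tss -> a \in s -> b \in s -> b <= a + U) ->
  (forall s t, s \in tss -> t \in s -> t <= lam) ->
  (forall m, m * l <= U.*2 -> 2 ^ m <= Z) ->
  wp explore (load (word tss)) (fun T s =>
    T <= 2000 * (K * Z) * maxn 1 lam /\ (accepting s <-> schedulable tss)).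
Proof.
move=> l0 K0 Z0 st sz gp sp tm hZ.
apply: vc_wp => /=.
set s0 := load _.
have rd0 : reading tss l U lam s0 0
    (update (update (update s0 vTodo 0 (size tss)) vPtr 0 1) vW 0 1).
  split=> //=.
  - by frame_solve.
  - by rewrite subn0.
  - by move=> j; rewrite add1n drop0.
  - by left.
apply: wp_conseq (read_leavesP l0 st sz gp sp tm (leq0n _) rd0) _.
rewrite subn0 => T s [leT [[bad [fr nsch]]|rd]].
  rewrite bad; split; first by clear -leT K0 Z0; nia.
  by rewrite /accepting fr.
have fr := rd_frame rd.
rewrite (rd_bad rd) /=.
(* Without leaves no gap has been measured and [vM] is 0, so the sweep is empty and the entry of the
   empty set yields acceptance. *)
case: (posnP (size tss)) => [n0|n0].
  apply: wp_whileF; first by rewrite /= (rd_time0 rd n0).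
  split; first by clear -leT K0 Z0; rewrite /=; nia.
  rewrite /accepting /= (rd_w rd) n0 expn0 subnn /=; split=> // _.
  by exists [::] => // i; rewrite n0.
have L0 := rd_gap_pos rd n0.
have lL : l <= s vL 0 by case: (rd_gap_min rd) => [L1|//]; rewrite L1 in L0.
(* The measured gap is at least [l] and the measured spread at most [U], so the test of the program
   is at least as strict as the premise on [Z]. *)
have hZ' m : m * s vL 0 <= (s vB 0).*2 -> 2 ^ m <= Z.
  move=> le; apply: hZ; apply: (@leq_trans (m * s vL 0)); first by rewrite leq_mul2l lL orbT.
  by apply: leq_trans le _; rewrite leq_double (rd_span_max rd).
apply: wp_conseq (@process_allP (s vL 0) (s vB 0) Z L0 Z0 hZ' _ (events tss (size tss))
  (s vEv 0) (s vM 0) _ _ _ _) _ => //=.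
- split=> //=; first by rewrite fr.
    rewrite -[update _ vT _ _ aTab]/(fun j => if j == 0 then 1 else s aTab j) fr //.
  by rewrite fr.
- by move=> t; apply: linked_eq (rd_log rd t) => a j; rewrite !inE => /or4P[]/eqP->.
move=> T' s' [leT' w' [_ _ _ tab' _]].
have ltM x t : x \in tss -> t \in x -> t < s vM 0.
  by move=> xin tin; rewrite -(nth_index [::] xin) in tin;
     apply: (rd_time rd) tin; rewrite index_mem.
split.
  have le1 := size_sweep (s vM 0) (events tss (size tss)).
  have le2 := size_events (size tss) sz.
  have le3 := rd_time_max rd; have le4 := rd_lam rd.
  have le5 : size (sweep (s vM 0) (events tss (size tss))) <= maxn 1 lam * K.
    apply: leq_trans le1 (leq_trans le2 _); rewrite leq_mul2r; apply/orP; right.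
    by rewrite leq_max le4 orbT.
  clear -leT leT' le5 le3 K0 Z0; move: (size (sweep _ _)) le5 leT' => q le5 leT'.
  move: (s vM 0) le3 leT' => M le3 leT'.
  have lemx : lam.+1 <= (maxn 1 lam).*2 by lia.
  have mx0 : 0 < maxn 1 lam by lia.
  move: (maxn 1 lam) lemx mx0 le5 => m lemx m0 le5.
  have h1 : T <= 700 * (K * Z * m) + 3.
    apply: leq_trans leT _; rewrite leq_add2r.
    apply: (@leq_trans (350 * K * m.*2)); first by apply: leq_mul => //; lia.
    have : K * m <= K * Z * m by rewrite leq_mul2r leq_pmulr ?orbT.
    by rewrite -mul2n; nia.
  have h2 : Z * q <= K * Z * m by rewrite mulnC; nia.
  have h3 : m <= K * Z * m by rewrite leq_pmull // muln_gt0 K0.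
  by rewrite -[2000 * _ * _]mulnA; lia.
rewrite /accepting /= tab' w' /= (rd_w rd) subn1; split.
  exact: run_sound.
apply: run_complete => // x a b xin.
  move=> ab; rewrite -(nth_index [::] xin) in ab.
  by have [|] := rd_gap rd _ ab; rewrite ?index_mem.
move=> ain bin; rewrite -(nth_index [::] xin) in ain bin.
by apply: (rd_span rd) ain bin; rewrite index_mem.
Qed.

(** * Walks in temporal stars *)

Lemma infix_next s a b : sorted ltn s -> a \in s -> b \in s -> a < b ->
  exists2 b', infix [:: a; b'] s & b' <= b.
Proof.
move=> + ain; case/splitPr: ain => s1 s2.
rewrite (sorted_pairwise ltn_trans) pairwise_cat mem_cat inE.
case/and3P=> /allrelP s1a _ /andP[_ ps2] /or3P[bs1|/eqP->|bs2] ab.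
- by have := s1a b a bs1 (mem_head _ _); rewrite ltnNge (ltnW ab).
- by rewrite ltnn in ab.
case: s2 ps2 bs2 {s1a} => // b' s2 /andP[/allP lt _] bs2; exists b'.
  by apply/infixP; exists s1, s2.
by move: bs2; rewrite inE => /orP[/eqP-> //|/lt/ltnW].
Qed.

(** Only the last visit to each leaf is kept; being a subsequence preserves disjointness. *)
Lemma uniq_visits (c : seq visit) :
  exists c', [/\ subseq c' c, uniq (unzip1 c') & unzip1 c' =i unzip1 c].
Proof.
elim: c => [|v c [c' [sc uc mc]]]; first by exists [::].
case vc: (v.1 \in unzip1 c').
  exists c'; split=> //; first by apply: (subseq_trans sc); apply: subseq_cons.
  by move=> i; rewrite inE -mc; case: eqP => // ->.
exists (v :: c'); rewrite /= eqxx vc; split=> // i.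
by rewrite !inE mc.
Qed.

Lemma last_head_gap u t ts :
  (forall a b, infix [:: a; b] (t :: ts) -> b <= a + u) -> last t ts <= t + size ts * u.
Proof.
elim: ts t => [|t' ts IHts] t gap /=; first by rewrite leq_addr.
have h1 : t' <= t + u by apply: gap; apply/infixP; exists [::], ts.
apply: (@leq_trans (t' + size ts * u)); last by rewrite mulSn addnA leq_add2r.
apply: IHts; by move=> a b ab; apply: gap; rewrite infix_consl ab orbT.
Qed.

Section Star.
Variables (n : nat) (tau : labelling (star n)).

Definition leaf_edge (i : 'I_n) : {set star n} := [set center n; leaf i].
Definition times (i : 'I_n) : seq nat := sort leq (tau (leaf_edge i)).
Definition table : seq (seq nat) := [seq times i | i <- enum 'I_n].

Lemma size_table : size table = n.
Proof. by rewrite size_map size_enum_ord. Qed.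

Lemma nth_table (i : 'I_n) : nth [::] table i = times i.
Proof. by rewrite (nth_map i) ?size_enum_ord // nth_ord_enum. Qed.

Lemma tableP s : s \in table -> exists i, s = times i.
Proof. by case/mapP=> i _ ->; exists i. Qed.

Lemma encode_word : encode tau = word table.
Proof. by rewrite /encode /word size_table /table -[in RHS]map_comp. Qed.

Lemma mem_times i t : (t \in times i) = (t \in tau (leaf_edge i)).
Proof. by rewrite mem_sort. Qed.

Lemma times_sorted i : sorted ltn (times i).
Proof.
rewrite ltn_sorted_uniq_leq sort_uniq fset_uniq /=.
by apply: sort_sorted; exact: leq_total.
Qed.

Lemma table_sorted s : s \in table -> sorted ltn s.
Proof. by case/tableP=> i ->; apply: times_sorted. Qed.

Lemma leaf_edge_in i : leaf_edge i \in edges (star n).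
Proof. by apply/imsetP; exists (center n, leaf i); rewrite ?inE. Qed.

Lemma edge_adj (x y : star n) : [set x; y] \in edges (star n) -> adj x y.
Proof.
case/imsetP=> [[p q]]; rewrite inE /= => pq E.
have: x \in [set p; q] by rewrite -E set21.
have: y \in [set p; q] by rewrite -E set22.
have: p \in [set x; y] by rewrite E set21.
have: q \in [set x; y] by rewrite E set22.
rewrite !inE => /orP[]/eqP E1 /orP[]/eqP E2 /orP[]/eqP E3 /orP[]/eqP E4; subst;
  by rewrite ?pq // star_adj_sym.
Qed.

Lemma infix_consecutive i a b :
  infix [:: a; b] (times i) -> consecutive tau (leaf_edge i) a b.
Proof.
move=> ab; have sub := mem_infix ab; split; rewrite -?mem_times ?sub ?inE ?eqxx ?orbT //.
  by move/infixP: ab (times_sorted i) => [s1 [s2 ->]];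
     rewrite (sorted_pairwise ltn_trans) pairwise_cat => /and3P[_ _ /andP[/andP[]]].
move=> r; rewrite -mem_times.
move/infixP: ab (times_sorted i) => [s1 [s2 ->]].
rewrite (sorted_pairwise ltn_trans) pairwise_cat mem_cat !inE.
case/and3P=> /allrelP s1a _ /andP[_ /andP[/allP bs2 _]].
case/or4P=> [/s1a/(_ (mem_head _ _))|/eqP->|/eqP->|/bs2]; rewrite ?ltnn ?andbF //=; lia.
Qed.

(** The walk alternates between center and leaves, so it is read two time-edges at a time. The
    return is moved back to the first active time after the departure, which keeps the intervals
    disjoint; the clause on start times serves the induction. *)
Lemma walk_visits vs w :
  temporal_walk tau (center n) (center n) vs w ->
  exists c, [/\ all (valid table) c, pairwise before c,
    {in c, forall v, v.2.1 \in unzip2 w}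
    & forall i, leaf i \in vs -> nat_of_ord i \in unzip1 c].
Proof.
have [m] := ubnP (size vs); elim: m vs w => // m IHm [|x vs] w szm [].
  by case: w => // _ _ _ _; exists [::].
case: w => [|[e1 t1] w] //= /andP[/andP[/= ed1 tin1] tw] [E1 Ew] lst srt.
rewrite {}E1 in ed1 tin1.
case: x ed1 tin1 Ew lst szm => [i|] ed1; last by have := edge_adj ed1.
case: vs => [|x vs] // tin1; case: w tw srt => [|[e2 t2] w] //= /andP[/andP[/= ed2 tin2] tw].
move=> /andP[t12 srt] [E2 Ew] lst szm; rewrite {}E2 in ed2 tin2.
case: x ed2 tin2 Ew lst => [j|] ed2; first by have := edge_adj ed2.
move=> tin2 Ew lst; rewrite setUC in tin2.
have [c [vc pc sc lc]] : exists c, [/\ all (valid table) c, pairwise before c,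
    {in c, forall v, v.2.1 \in unzip2 w}
    & forall i, leaf i \in vs -> nat_of_ord i \in unzip1 c].
  apply: IHm; first exact: ltnW szm.
  by split=> //; apply: path_sorted srt.
have [b ib bt2] : exists2 b, infix [:: t1; b] (times i) & b <= t2.
  by apply: infix_next; rewrite ?mem_times //; apply: times_sorted.
exists ((nat_of_ord i, (t1, b)) :: c); split.
- by rewrite /= vc /valid /= nth_table ib.
- rewrite /= pc andbT; apply/allP => v /sc vin.
  rewrite /before /=; apply: leq_ltn_trans bt2 _.
  by have /allP := order_path_min ltn_trans srt; apply.
- by move=> v; rewrite inE => /orP[/eqP->|/sc]; rewrite /= !inE ?eqxx // => ->; rewrite !orbT.
- move=> j; rewrite !inE => /or3P[/eqP[->]|//|/lc ->]; by rewrite ?eqxx ?orbT.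
Qed.

(** Each visit becomes two traversals of its edge; the lower bound on the times of the walk allows
    prepending an earlier visit. *)
Lemma visits_walk c : all (valid table) c -> pairwise before c ->
  exists vs w, [/\ temporal_walk tau (center n) (center n) vs w,
    {in unzip2 w, forall t, exists2 v, v \in c & v.2.1 <= t}
    & forall i, nat_of_ord i \in unzip1 c -> leaf i \in vs].
Proof.
elim: c => [|v c IHc] /=; first by move=> _ _; exists [::], [::].
case/andP=> vv vc /andP[/allP bc pc]; have [vs [w [[tw Ew lst srt] bw lw]]] := IHc vc pc.
have ltn_v : v.1 < n by have [/nth_tss_size + _] := valid_mem vv; rewrite size_table.
have [a_in b_in] := valid_mem vv.
pose i := Ordinal ltn_v.
have Ei : nth [::] table v.1 = times i by rewrite -[v.1]/(nat_of_ord i) nth_table.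
rewrite Ei !mem_times in a_in b_in.
have ltv := valid_lt table_sorted vv.
exists [:: leaf i, center n & vs].
exists [:: ([set center n; leaf i], v.2.1), ([set leaf i; center n], v.2.2) & w]; split.
- split=> //=.
  + rewrite tw andbT [[set leaf i; _]]setUC -/(leaf_edge i) /time_edge /=.
    by rewrite leaf_edge_in a_in b_in.
  + by rewrite Ew.
  + rewrite ltv /= path_min_sorted //; apply/allP => t /bw[v' /bc].
    exact: leq_trans.
- move=> t; rewrite !inE => /or3P[/eqP->|/eqP->|/bw[v' v'c le]].
  + by exists v; rewrite ?mem_head.
  + by exists v; rewrite ?mem_head // ltnW.
  + by exists v'; rewrite // inE v'c orbT.
- move=> j; rewrite !inE => /orP[/eqP jv|/lw ->]; last by rewrite !orbT.
  by apply/orP; left; apply/eqP; congr Some; apply: val_inj.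
Qed.

Lemma explorable_schedulable : explorable tau <-> schedulable table.
Proof.
split=> [[vs [w [tw cov]]]|[c /and3P[vc pc uc] cf]].
  have [c [vc pc _ lc]] := walk_visits tw.
  have [c' [sc uc' mc]] := uniq_visits c.
  exists c'.
    apply/and3P; split=> //; last exact: subseq_pairwise pc.
    by apply/allP => v /(mem_subseq sc)/(allP vc).
  move=> i; rewrite size_table => lti; rewrite mc; apply: (lc (Ordinal lti)).
  by have := cov (Ordinal lti); rewrite inE.
have [vs [w [tw _ lc]]] := visits_walk vc pc.
exists vs, w; split=> // i; rewrite inE lc //.
by apply: cf; rewrite size_table.
Qed.

Lemma time_lifetime i t : t \in times i -> t <= lifetime tau.
Proof.
rewrite mem_times => tin; rewrite /lifetime.
apply: leq_trans (leq_bigmax_cond _ (leaf_edge_in i)).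
exact: (@leq_bigmax_seq _ _ xpredT id).
Qed.

(** * Bounds on the number and the spread of the times of a leaf *)

Section Gaps.
Variables (k l u : nat).
Hypothesis times_k : at_most_times tau k.
Hypothesis gaps_lu : gaps_between tau l u.

Lemma size_times i : size (times i) <= k.
Proof. by rewrite size_sort; apply: times_k; apply: leaf_edge_in. Qed.

Lemma times_gap i a b : infix [:: a; b] (times i) -> a + l <= b <= a + u.
Proof.
move=> /infix_consecutive ab; have := gaps_lu (leaf_edge_in i) ab.
by case: ab => _ _; lia.
Qed.

Lemma times_span i a b : a \in times i -> b \in times i -> b <= a + k * u.
Proof.
have := times_sorted i; have := size_times i; have := @times_gap i.
case: (times i) => // t ts gap sz st ain bin.
have /andP[ta _] := sorted_bounds st ain; have /andP[_ bl] := sorted_bounds st bin.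
apply: leq_trans bl _.
have h : last t ts <= t + size ts * u.
  by apply: last_head_gap => // x y /gap/andP[].
apply: leq_trans h _; apply: leq_add => //.
by rewrite leq_mul2r ltnW ?orbT.
Qed.

Hypothesis l_gt0 : 0 < l.

(** Absorbs the factor [k] of the running time into the exponential: a leaf with two times forces
    [l <= u], so [k] is at most [(k * u) %/ l]. *)
Lemma times_size_exp i : size (times i) <= 2 ^ ((k * u) %/ l).
Proof.
case: (leqP (size (times i)) 1) => [le1|lt1].
  by apply: leq_trans le1 _; rewrite expn_gt0.
have lu : l <= u.
  case E: (times i) lt1 => [|a [|b s]] // _.
  have: infix [:: a; b] (times i) by rewrite E; apply/infixP; exists [::], s.
  by move/times_gap; lia.
have le_k : k <= 2 ^ k by apply: ltnW; apply: ltn_expl.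
apply: leq_trans (size_times i) (leq_trans le_k _).
by rewrite leq_exp2l // leq_divRL // leq_mul2l lu orbT.
Qed.

End Gaps.
End Star.

Theorem theorem5p3 :
  exists (A : prog) (C : nat),
    forall (n : nat) (tau : labelling (star n)) (k l u : nat),
      0 < l -> at_most_times tau k -> gaps_between tau l u ->
      decides_within A (encode tau) (explorable tau)
        (C * 2 ^ ((C * (k * u)) %/ l) * maxn 1 (lifetime tau)).
Proof.
exists explore, 2000 => n tau k l u l0 hk hg.
(* The spread is at most [k * u]; at most [(k * u).*2 %/ l] leaves are then live at an event that is
   not skipped, which gives [Z]. *)
have [||||| T [s [ex [leT acc]]]] := @exploreP (table tau) l (2 ^ ((k * u) %/ l)) (k * u)
  (lifetime tau) (2 ^ ((k * u).*2 %/ l)) l0 (expn_gt0 2 _) (expn_gt0 2 _)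
  (@table_sorted _ tau) _ _ _ _ _.
- by move=> s /tableP[i ->]; apply: times_size_exp hk hg l0 i.
- by move=> s /tableP[i ->] a b /(times_gap hg)/andP[].
- by move=> s a b /tableP[i ->]; apply: (times_span hk hg).
- by move=> s t /tableP[i ->]; apply: time_lifetime.
- by move=> m le; rewrite leq_exp2l // leq_divRL.
exists T, s; split; first by rewrite encode_word.
(* The exponents of [K] and [Z] add up to at most [3 * (k * u) %/ l], well below the exponent with
   [C = 2000], the constant factor of [exploreP]. *)
- apply: leq_trans leT _; rewrite leq_mul2r leq_mul2l; apply/orP; right; apply/orP; right.
  rewrite -expnD leq_exp2l // leq_divRL // mulnDl.
  apply: leq_trans (leq_add (leq_trunc_div _ _) (leq_trunc_div _ _)) _.
  by rewrite -muln2 -mulnS mulnC leq_mul2r orbT.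
- by rewrite explorable_schedulable.
Qed.
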